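(* If $\kappa$ is a measurable cardinal, then $\kappa$ is a limit of regular cardinals $\alpha<\kappa$ which are $\alpha$-Ramsey.
   Context: The background theory is ZFC. For a cardinal $\alpha$, an $\alpha$-model is a (not necessarily transitive) set $M$ of size $\alpha$ with $\alpha+1\subseteq M$, $\langle M,\in\rangle\models\mathrm{ZFC}^-$ (ZFC without power set, with the collection scheme) and $M^{<\alpha}\subseteq M$. An elementary embedding $j\colon M\to N$ (where $N$ is a set with the true membership relation) is $\alpha$-powerset preserving if it has critical point $\alpha$ and $\mathcal P(\alpha)\cap M=\mathcal P(\alpha)\cap N$. A regular cardinal $\alpha$ is $\alpha$-Ramsey if for arbitrarily large (i.e. unboundedly many) regular cardinals $\theta$, every $A\subseteq\alpha$ is an element of some $\alpha$-model $M\prec H(\theta)$ for which there exists an $\alpha$-powerset preserving elementary embedding $j\colon M\to N$. *)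

(* Defs.v *)
(** * Membership structures and first-order satisfaction *)

Record structure : Type := Structure {
  carrier :> Type;
  mem : carrier -> carrier -> Prop
}.
Arguments mem {s} x y.

Declare Scope st_scope.
Delimit Scope st_scope with st.
Open Scope st_scope.
Notation "x ∈ y" := (mem x y) (at level 70, no associativity) : st_scope.

(* The structure whose elements are the elements of [M], with the true
   membership relation. *)
Definition sub {V : structure} (M : V) : structure :=
  Structure {x : V | x ∈ M} (fun x y => proj1_sig x ∈ proj1_sig y).

(* Formulas of the language of set theory, with de Bruijn indices. *)
Inductive formula : Type :=
| f_mem (i j : nat)
| f_eq (i j : nat)
| f_bot
| f_imp (p q : formula)
| f_all (p : formula).

Definition scons {A : Type} (x : A) (s : nat -> A) (n : nat) : A :=
  match n with O => x | S m => s m end.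

Fixpoint sat {A : structure} (p : formula) (s : nat -> A) : Prop :=
  match p with
  | f_mem i j => s i ∈ s j
  | f_eq i j => s i = s j
  | f_bot => False
  | f_imp q r => sat q s -> sat r s
  | f_all q => forall x : A, sat q (scons x s)
  end.

Definition elementary {A B : structure} (f : A -> B) : Prop :=
  forall (p : formula) (s : nat -> A), sat p s <-> sat p (fun n => f (s n)).

(* M ≺ H, for sets M and H. *)
Definition elementary_sub {V : structure} (M H : V) : Prop :=
  exists i : sub M -> sub H,
    (forall x, proj1_sig (i x) = proj1_sig x) /\ elementary i.

(** * Basic notions, interpreted in an arbitrary structure *)

Definition subset {A : structure} (x y : A) : Prop :=
  forall z, z ∈ x -> z ∈ y.
Notation "x ⊆ y" := (subset x y) (at level 70, no associativity) : st_scope.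

Definition is_empty {A : structure} (x : A) : Prop := forall z, ~ z ∈ x.

Definition is_succ {A : structure} (x s : A) : Prop :=
  forall z, z ∈ s <-> z ∈ x \/ z = x.

Definition is_upair {A : structure} (x y p : A) : Prop :=
  forall z, z ∈ p <-> z = x \/ z = y.

Definition is_opair {A : structure} (x y p : A) : Prop :=
  exists a b, is_upair x x a /\ is_upair x y b /\ is_upair a b p.

Definition related {A : structure} (r x y : A) : Prop :=
  exists p, is_opair x y p /\ p ∈ r.

Definition well_orders {A : structure} (r x : A) : Prop :=
  (forall y, y ∈ x -> ~ related r y y) /\
  (forall y z t, y ∈ x -> z ∈ x -> t ∈ x ->
     related r y z -> related r z t -> related r y t) /\
  (forall y z, y ∈ x -> z ∈ x -> related r y z \/ y = z \/ related r z y) /\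
  (forall u, u ⊆ x -> (exists y, y ∈ u) ->
     exists y, y ∈ u /\ forall z, z ∈ u -> y = z \/ related r y z).

Definition inductive {A : structure} (w : A) : Prop :=
  (exists e, is_empty e /\ e ∈ w) /\
  (forall x, x ∈ w -> exists s, is_succ x s /\ s ∈ w).

(** * ZFC and ZFC^- *)

(* The single axioms common to ZFC and ZFC^-. Choice is taken as the
   well-ordering principle: this is the usual formulation for ZFC^-, since the
   forms of choice need not be equivalent without the power set axiom. *)
Record base_axioms (A : structure) : Prop := {
  ax_extensionality : forall x y : A, (forall z, z ∈ x <-> z ∈ y) -> x = y;
  ax_foundation : forall x : A, (exists y, y ∈ x) ->
    exists y, y ∈ x /\ forall z, z ∈ x -> ~ z ∈ y;
  ax_pairing : forall x y : A, exists p, is_upair x y p;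
  ax_union : forall x : A,
    exists u, forall z, z ∈ u <-> exists y, y ∈ x /\ z ∈ y;
  ax_infinity : exists w : A, inductive w;
  ax_choice : forall x : A, exists r, well_orders r x
}.

(* The universe of sets. As V is the universe in which one reasons, rather than
   an object of study, separation and replacement apply to every class, i.e. to
   every Rocq predicate or functional relation on V. Consequently the natural
   numbers of V are the standard ones, [formula] lists exactly the formulas of
   the object language as seen in V, and any Rocq function between two sets
   of V has a graph in V. *)
Record ZFC (V : structure) : Prop := {
  zfc_base : base_axioms V;
  zfc_power : forall x : V, exists p, forall y, y ∈ p <-> y ⊆ x;
  zfc_separation : forall (P : V -> Prop) (x : V),
    exists y, forall z, z ∈ y <-> z ∈ x /\ P z;
  zfc_replacement : forall (R : V -> V -> Prop) (x : V),
    (forall a b c, a ∈ x -> R a b -> R a c -> b = c) ->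
    exists y, forall b, b ∈ y <-> exists a, a ∈ x /\ R a b
}.

(* First-order: the assignment [s] supplies the parameters. *)
Record ZFCminus (A : structure) : Prop := {
  zfcm_base : base_axioms A;
  zfcm_separation : forall (p : formula) (s : nat -> A) (x : A),
    exists y, forall z, z ∈ y <-> z ∈ x /\ sat p (scons z s);
  zfcm_collection : forall (p : formula) (s : nat -> A) (x : A),
    (forall a, a ∈ x -> exists b, sat p (scons a (scons b s))) ->
    exists y, forall a, a ∈ x ->
      exists b, b ∈ y /\ sat p (scons a (scons b s))
}.

(** * Functions, ordinals and cardinals *)

Definition is_function {V : structure} (f x y : V) : Prop :=
  (forall p, p ∈ f -> exists a b, a ∈ x /\ b ∈ y /\ is_opair a b p) /\
  (forall a, a ∈ x -> exists! b, related f a b).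

Definition is_bijection {V : structure} (f x y : V) : Prop :=
  is_function f x y /\ (forall b, b ∈ y -> exists! a, related f a b).

Definition equinumerous {V : structure} (x y : V) : Prop :=
  exists f, is_bijection f x y.

Definition transitive {V : structure} (x : V) : Prop :=
  forall y, y ∈ x -> y ⊆ x.

(* Well-foundedness of membership on [x] is given by the foundation axiom. *)
Definition ordinal {V : structure} (x : V) : Prop :=
  transitive x /\ (forall y z, y ∈ x -> z ∈ x -> y ∈ z \/ y = z \/ z ∈ y).

Definition cardinal {V : structure} (k : V) : Prop :=
  ordinal k /\ forall b, b ∈ k -> ~ equinumerous b k.

(* |x| < k, for a cardinal k. *)
Definition smaller {V : structure} (x k : V) : Prop :=
  exists b, b ∈ k /\ equinumerous x b.

Definition is_omega {V : structure} (w : V) : Prop :=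
  inductive w /\ forall v, inductive v -> w ⊆ v.

Definition regular {V : structure} (k : V) : Prop :=
  cardinal k /\
  (exists w, is_omega w /\ w ⊆ k) /\
  (forall b f, b ∈ k -> is_function f b k ->
     exists c, c ∈ k /\ forall x y, related f x y -> y ∈ c).

Definition limit_of {V : structure} (k : V) (P : V -> Prop) : Prop :=
  forall b, b ∈ k -> exists a, a ∈ k /\ b ∈ a /\ P a.

(** * Measurable cardinals *)

Definition is_ultrafilter {V : structure} (U k : V) : Prop :=
  (forall X, X ∈ U -> X ⊆ k) /\
  k ∈ U /\
  (forall X, X ∈ U -> ~ is_empty X) /\
  (forall X Y, X ∈ U -> X ⊆ Y -> Y ⊆ k -> Y ∈ U) /\
  (forall X Y Z, X ∈ U -> Y ∈ U ->
     (forall z, z ∈ Z <-> z ∈ X /\ z ∈ Y) -> Z ∈ U) /\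
  (forall X Y, X ⊆ k -> (forall z, z ∈ Y <-> z ∈ k /\ ~ z ∈ X) ->
     X ∈ U \/ Y ∈ U).

Definition nonprincipal {V : structure} (U k : V) : Prop :=
  ~ exists x, x ∈ k /\ forall X, X ∈ U <-> X ⊆ k /\ x ∈ X.

Definition complete {V : structure} (U k : V) : Prop :=
  forall F I, F ⊆ U -> smaller F k ->
    (forall z, z ∈ I <-> z ∈ k /\ forall X, X ∈ F -> z ∈ X) -> I ∈ U.

Definition measurable {V : structure} (k : V) : Prop :=
  cardinal k /\
  (exists w, is_omega w /\ w ∈ k) /\
  (exists U, is_ultrafilter U k /\ complete U k /\ nonprincipal U k).

(** * Ramsey-like cardinals *)

Definition is_trcl {V : structure} (x t : V) : Prop :=
  x ⊆ t /\ transitive t /\ forall u, x ⊆ u -> transitive u -> t ⊆ u.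

(* h = H(θ), the set of all sets with transitive closure of size below θ. *)
Definition is_H {V : structure} (theta h : V) : Prop :=
  forall x, x ∈ h <-> exists t, is_trcl x t /\ smaller t theta.

Definition is_model {V : structure} (a M : V) : Prop :=
  equinumerous M a /\
  (a ⊆ M /\ a ∈ M) /\
  ZFCminus (sub M) /\
  (forall b f, b ∈ a -> is_function f b M -> f ∈ M).

(* [a] is the least ordinal moved by j. *)
Definition critical_point {V : structure} {M N : V}
    (j : sub M -> sub N) (a : V) : Prop :=
  (forall x : sub M, proj1_sig x ∈ a -> proj1_sig (j x) = proj1_sig x) /\
  (exists x : sub M, proj1_sig x = a /\ proj1_sig (j x) <> a).

Definition powerset_preserving {V : structure} {M N : V}
    (j : sub M -> sub N) (a : V) : Prop :=
  critical_point j a /\ (forall x : V, x ⊆ a -> (x ∈ M <-> x ∈ N)).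

(* For a regular cardinal α, "α is α-Ramsey". *)
Definition ramsey {V : structure} (a : V) : Prop :=
  regular a /\
  forall l : V, ordinal l -> exists theta,
    l ∈ theta /\ regular theta /\
    forall A : V, A ⊆ a -> exists M H : V,
      A ∈ M /\ is_model a M /\ is_H theta H /\ elementary_sub M H /\
      exists (N : V) (j : sub M -> sub N),
        elementary j /\ powerset_preserving j a.

(* Main.v *)
From Stdlib Require Import Classical ClassicalEpsilon FunctionalExtensionality.
From Stdlib Require Import ProofIrrelevance PropExtensionality Cantor.
Require Import Defs.

(** Fix a normal measure nu on k, and say that a property holds for almost every a < k if
nu gives it measure one. The theorem follows from the claim that almost every a < k is regular
and a-Ramsey.

The classical reason for the claim: in the ultrapower W of the universe by nu, the cardinal k is
k-Ramsey. For a subset A of k one builds, outside W, an elementary submodel M of an H(theta) of W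
that has size k, contains A, is closed under sequences shorter than k, and is such that for each
sequence in M of k many subsets of k, the set of indices whose term has measure one belongs to M.
The last property makes the ultrapower embedding of M by nu powerset preserving. As W is closed
under k-sequences, M and the embedding lie in W, and the theorem of Los reflects this to almost
every a < k.

The proof below runs this argument with functions on k in place of their classes, so that neither
W nor any other ultrapower is formed. Suppose the claim fails. All the bounds that witness the
failure lie below one regular theta ([theta], with the set H = H(theta)), so that almost every a
has a subset A a for which no suitable model and embedding exist in H. A system of terms is then
evaluated in H: [ev t x y] is the value of the term t at two ordinals x and y below k. For a < b
put

   M = the values [ev t a a], N = the values [ev t a b], over the terms t of index below a,

and let j send [ev t a a] to [ev t b b]. The set M plays the role of the model above, and N that
of its ultrapower, realised inside H. The operations that build terms provide what is needed of M,
N and j: Skolem functions make M and N elementary in H ([hull_elementary]), sequencing closes M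
under short sequences ([hull_model]), the operation [up] puts the values of j into N, [low] puts M
into N, and [lim] recovers every subset of a that lies in N as an element of M ([emb_powerset]).

There are only k many terms ([index_ex]), because a measure is so complete that a function from k
to a small set of terms is almost everywhere constant ([bounded_const]). Normality extends this to
functions that choose at a a term of index below a ([normal_term]). Hence for almost every a the
terms of index below a are closed under the operations ([closed_ae]), and the first-order
properties of their diagonal values at a are the ones that hold almost everywhere ([truth_ae]).
The latter makes the properties the same at a and at b, which is the elementarity of j
([truth_shift]), and constants make a the critical point. *)

Definition chosen {A : Type} {P : A -> Prop} (h : exists x, P x) : A :=
  proj1_sig (constructive_indefinite_description P h).

Lemma chosenP {A : Type} {P : A -> Prop} (h : exists x, P x) : P (chosen h).
Proof. exact (proj2_sig (constructive_indefinite_description P h)). Qed.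

Lemma choice_on {A B : Type} (D : A -> Prop) (R : A -> B -> Prop) (b0 : B) :
  (forall x, D x -> exists y, R x y) -> exists f, forall x, D x -> R x (f x).
Proof.
  intros h.
  assert (h' : forall x, exists y, D x -> R x y).
  { intros x; destruct (classic (D x)) as [d|d].
    - destruct (h x d) as [y r]; now exists y.
    - exists b0; tauto. }
  exists (fun x => chosen (h' x)); intros x; exact (chosenP (h' x)).
Qed.

(** * First-order definability and elementary maps *)

Definition f_not p := f_imp p f_bot.
Definition f_and p q := f_not (f_imp p (f_not q)).
Definition f_or p q := f_imp (f_not p) q.
Definition f_iff p q := f_and (f_imp p q) (f_imp q p).
Definition f_ex p := f_not (f_all (f_not p)).

Lemma sat_and (A : structure) p q (s : nat -> A) : sat (f_and p q) s <-> sat p s /\ sat q s.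
Proof. simpl; destruct (classic (sat p s)), (classic (sat q s)); tauto. Qed.
Lemma sat_or (A : structure) p q (s : nat -> A) : sat (f_or p q) s <-> sat p s \/ sat q s.
Proof. simpl; destruct (classic (sat p s)); tauto. Qed.
Lemma sat_iff (A : structure) p q (s : nat -> A) :
  sat (f_iff p q) s <-> (sat p s <-> sat q s).
Proof. unfold f_iff; rewrite sat_and; simpl; tauto. Qed.
Lemma sat_ex (A : structure) p (s : nat -> A) :
  sat (f_ex p) s <-> exists x, sat p (scons x s).
Proof.
  simpl; split.
  - intros h; apply NNPP; intros h'; apply h; intros x hx; apply h'; eauto.
  - intros [x hx] h; now apply (h x).
Qed.

Lemma scons_map {A B : Type} (f : A -> B) x s :
  (fun n => f (scons x s n)) = scons (f x) (fun n => f (s n)).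
Proof. apply functional_extensionality; now intros [|n]. Qed.

Fixpoint rename (r : nat -> nat) (p : formula) : formula :=
  match p with
  | f_mem i j => f_mem (r i) (r j)
  | f_eq i j => f_eq (r i) (r j)
  | f_bot => f_bot
  | f_imp p q => f_imp (rename r p) (rename r q)
  | f_all p => f_all (rename (fun n => match n with 0 => 0 | S m => S (r m) end) p)
  end.

Lemma sat_rename (A : structure) p : forall r (s : nat -> A),
  sat (rename r p) s <-> sat p (fun n => s (r n)).
Proof.
  induction p as [i j|i j| |p IHp q IHq|p IHp]; intros r s; simpl; try tauto.
  - now rewrite IHp, IHq.
  - assert (E : forall x, (fun n => scons x s (match n with 0 => 0 | S m => S (r m) end))
      = scons x (fun n => s (r n))).
    { intros x; apply functional_extensionality; now intros [|n]. }
    split; intros h x; specialize (h x).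
    + apply IHp in h; now rewrite E in h.
    + apply IHp; now rewrite E.
Qed.

(** One formula has to serve for all structures at once, since it is used to carry a statement
from one structure to another. The closure lemmas below have the shape of the corresponding
binders and connectives, so that definability of a concrete notion is proved by unfolding it. *)
Definition definable (P : forall A : structure, (nat -> A) -> Prop) : Prop :=
  exists p, forall A s, sat p s <-> P A s.

Lemma def_mem i j : definable (fun A s => s i ∈ s j).
Proof. now exists (f_mem i j). Qed.
Lemma def_eq i j : definable (fun A s => s i = s j).
Proof. now exists (f_eq i j). Qed.
Lemma def_bot : definable (fun A s => False).
Proof. now exists f_bot. Qed.
Lemma def_imp P Q : definable P -> definable Q -> definable (fun A s => P A s -> Q A s).
Proof. intros [p hp] [q hq]; exists (f_imp p q); intros A s; simpl; now rewrite hp, hq. Qed.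
Lemma def_and P Q : definable P -> definable Q -> definable (fun A s => P A s /\ Q A s).
Proof. intros [p hp] [q hq]; exists (f_and p q); intros A s; now rewrite sat_and, hp, hq. Qed.
Lemma def_or P Q : definable P -> definable Q -> definable (fun A s => P A s \/ Q A s).
Proof. intros [p hp] [q hq]; exists (f_or p q); intros A s; now rewrite sat_or, hp, hq. Qed.
Lemma def_all (Q : forall A : structure, A -> (nat -> A) -> Prop) :
  definable (fun A t => Q A (t 0) (fun n => t (S n))) ->
  definable (fun A s => forall x : A, Q A x s).
Proof. intros [p hp]; exists (f_all p); intros A s; split; intros h x; apply (hp A (scons x s)), h. Qed.
Lemma def_ex (Q : forall A : structure, A -> (nat -> A) -> Prop) :
  definable (fun A t => Q A (t 0) (fun n => t (S n))) ->
  definable (fun A s => exists x : A, Q A x s).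
Proof.
  intros [p hp]; exists (f_ex p); intros A s; rewrite sat_ex.
  split; intros [x h]; exists x; apply (hp A (scons x s)), h.
Qed.

Ltac definability :=
  repeat (cbv beta;
    first [ apply def_mem | apply def_eq | apply def_bot | apply def_and | apply def_or
          | apply def_ex | apply def_all | apply def_imp ]).

Section Transfer.
Variables (A B : structure) (f : A -> B) (a0 : A).
Hypothesis hf : elementary f.

Lemma transfer P : definable P -> (forall s : nat -> B, P B s) -> forall s : nat -> A, P A s.
Proof. intros [p hp] h s; apply hp, hf, hp, h. Qed.

(* Each axiom is a closed sentence: read it as a function of the structure and show that this
function is definable. *)
Ltac transfer_axiom hB ax :=
  let H := fresh in
  pose proof (ax B hB) as H;
  match type of H with
  | ?T =>
    let P := eval pattern B in T in
    match P with
    | ?F _ => change (F A);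
      refine (transfer (fun C _ => F C) _ (fun _ => H) (fun _ => a0))
    end
  end;
  unfold inductive, well_orders, related, is_opair, is_upair, is_succ, is_empty, subset, iff, not;
  definability.

Lemma base_axioms_transfer : base_axioms B -> base_axioms A.
Proof.
  intros hB; split.
  - transfer_axiom hB ax_extensionality.
  - transfer_axiom hB ax_foundation.
  - transfer_axiom hB ax_pairing.
  - transfer_axiom hB ax_union.
  - transfer_axiom hB ax_infinity.
  - transfer_axiom hB ax_choice.
Qed.

(** The axiom schemes have infinitely many parameters at their disposal, but a single formula
refers to finitely many, so each instance is one formula with the assignment as parameter. *)
Lemma ZFCminus_transfer : ZFCminus B -> ZFCminus A.
Proof.
  intros [hB hsep hcol]; split; [now apply base_axioms_transfer|..].
  - intros p s x.
    pose (q := f_ex (f_all (f_iff (f_mem 0 1) (f_and (f_mem 0 2)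
      (rename (fun n => match n with 0 => 0 | S m => S (S (S m)) end) p))))).
    assert (hq : forall (C : structure) (s : nat -> C) x, sat q (scons x s) <->
      exists y, forall z, z ∈ y <-> z ∈ x /\ sat p (scons z s)).
    { intros C s' x'; unfold q; rewrite sat_ex.
      split; intros [y h]; exists y; intros z; specialize (h z);
        rewrite sat_iff, sat_and, sat_rename in *; simpl in *;
        replace (scons z s') with (fun n => scons z (scons y (scons x' s'))
          (match n with 0 => 0 | S m => S (S (S m)) end)) in *; auto;
        apply functional_extensionality; now intros [|n]. }
    apply hq, hf; rewrite scons_map; apply hq, hsep.
  - intros p s x.
    pose (r := fun n => match n with 0 => 1 | 1 => 0 | S (S m) => S (S (S m)) end).
    pose (r' := fun n => match n with 0 => 1 | 1 => 0 | S (S m) => S (S (S (S m))) end).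
    pose (q := f_imp (f_all (f_imp (f_mem 0 1) (f_ex (rename r p))))
      (f_ex (f_all (f_imp (f_mem 0 2) (f_ex (f_and (f_mem 0 2) (rename r' p))))))).
    assert (e : forall (C : structure) (a b x : C) s, (fun n => scons b (scons a (scons x s)) (r n))
      = scons a (scons b s)).
    { intros; apply functional_extensionality; now intros [|[|n]]. }
    assert (e' : forall (C : structure) (a b y x : C) s,
      (fun n => scons b (scons a (scons y (scons x s))) (r' n)) = scons a (scons b s)).
    { intros; apply functional_extensionality; now intros [|[|n]]. }
    assert (hq : forall (C : structure) (s : nat -> C) x, sat q (scons x s) <->
      ((forall a, a ∈ x -> exists b, sat p (scons a (scons b s))) ->
      exists y, forall a, a ∈ x -> exists b, b ∈ y /\ sat p (scons a (scons b s)))).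
    { intros C s' x'; change (sat q (scons x' s')) with
        (sat (f_all (f_imp (f_mem 0 1) (f_ex (rename r p)))) (scons x' s') ->
         sat (f_ex (f_all (f_imp (f_mem 0 2) (f_ex (f_and (f_mem 0 2) (rename r' p))))))
           (scons x' s')).
      rewrite sat_ex.
      assert (E1 : sat (f_all (f_imp (f_mem 0 1) (f_ex (rename r p)))) (scons x' s') <->
        forall a, a ∈ x' -> exists b, sat p (scons a (scons b s'))).
      { split; intros h a ha.
        - specialize (h a ha); apply sat_ex in h; destruct h as [b h]; rewrite sat_rename in h.
          rewrite (e C a b x' s') in h; eauto.
        - apply sat_ex; destruct (h a ha) as [b hb]; exists b; rewrite sat_rename.
          now rewrite (e C a b x' s'). }
      rewrite E1; split; intros h h1; destruct (h h1) as [y hy]; exists y; intros a ha.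
      - specialize (hy a ha); apply sat_ex in hy; destruct hy as [b hb].
        apply sat_and in hb; rewrite sat_rename, (e' C a b y x' s') in hb; now exists b.
      - apply sat_ex; destruct (hy a ha) as [b hb]; exists b.
        apply sat_and; now rewrite sat_rename, (e' C a b y x' s'). }
    apply hq, hf; rewrite scons_map; apply hq, hcol.
Qed.
End Transfer.

Section Universe.
Variable V : structure.
Hypothesis HV : ZFC V.

(** * Elementary set theory in V *)

Lemma set_ext (x y : V) : (forall z, z ∈ x <-> z ∈ y) -> x = y.
Proof. apply (ax_extensionality V (zfc_base V HV)). Qed.

Definition sep (x : V) (P : V -> Prop) : V := chosen (zfc_separation V HV P x).
Lemma in_sep x P z : z ∈ sep x P <-> z ∈ x /\ P z.
Proof. exact (chosenP (zfc_separation V HV P x) z). Qed.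

Lemma img_ex (x : V) (f : V -> V) :
  exists y, forall b, b ∈ y <-> exists a, a ∈ x /\ b = f a.
Proof. apply (zfc_replacement V HV (fun a b => b = f a)); intros; congruence. Qed.
Definition img (x : V) (f : V -> V) : V := chosen (img_ex x f).
Lemma in_img x f z : z ∈ img x f <-> exists a, a ∈ x /\ z = f a.
Proof. exact (chosenP (img_ex x f) z). Qed.
Lemma img_in x f a : a ∈ x -> f a ∈ img x f.
Proof. intros h; apply in_img; eauto. Qed.

Definition power (x : V) : V := chosen (zfc_power V HV x).
Lemma in_power x z : z ∈ power x <-> z ⊆ x.
Proof. exact (chosenP (zfc_power V HV x) z). Qed.

Definition union (x : V) : V := chosen (ax_union V (zfc_base V HV) x).
Lemma in_union x z : z ∈ union x <-> exists y, y ∈ x /\ z ∈ y.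
Proof. exact (chosenP (ax_union V (zfc_base V HV) x) z). Qed.

Definition upair (x y : V) : V := chosen (ax_pairing V (zfc_base V HV) x y).
Lemma in_upair x y z : z ∈ upair x y <-> z = x \/ z = y.
Proof. exact (chosenP (ax_pairing V (zfc_base V HV) x y) z). Qed.

Definition empty : V := sep (chosen (ax_infinity V (zfc_base V HV))) (fun _ => False).
Lemma in_empty z : ~ z ∈ empty.
Proof. unfold empty; rewrite in_sep; tauto. Qed.

Definition cup (x y : V) : V := union (upair x y).
Lemma in_cup x y z : z ∈ cup x y <-> z ∈ x \/ z ∈ y.
Proof.
  unfold cup; rewrite in_union; split.
  - intros [u [h1 h2]]; apply in_upair in h1; destruct h1; subst; auto.
  - intros [h|h]; [exists x|exists y]; split; auto; apply in_upair; auto.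
Qed.

Definition succ (x : V) : V := cup x (upair x x).
Lemma in_succ x z : z ∈ succ x <-> z ∈ x \/ z = x.
Proof. unfold succ; rewrite in_cup, in_upair; tauto. Qed.

Lemma is_upair_eq x y p : is_upair x y p <-> p = upair x y.
Proof.
  split.
  - intros h; apply set_ext; intros z; rewrite in_upair; apply h.
  - intros ->; intros z; apply in_upair.
Qed.

Definition opair (x y : V) : V := upair (upair x x) (upair x y).
Lemma is_opair_eq x y p : is_opair x y p <-> p = opair x y.
Proof.
  split.
  - intros (a & b & h1 & h2 & h3).
    apply is_upair_eq in h1; apply is_upair_eq in h2; apply is_upair_eq in h3; now subst.
  - intros ->; exists (upair x x), (upair x y); repeat split; try apply in_upair.
Qed.

Lemma related_eq r x y : related r x y <-> opair x y ∈ r.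
Proof.
  split.
  - intros [p [h1 h2]]; apply is_opair_eq in h1; now subst.
  - intros h; exists (opair x y); split; auto; now apply is_opair_eq.
Qed.

Lemma upair_inj x y x' y' :
  upair x y = upair x' y' -> (x = x' /\ y = y') \/ (x = y' /\ y = x').
Proof.
  intros h.
  assert (h1 : x = x' \/ x = y') by (apply in_upair; rewrite <- h; apply in_upair; auto).
  assert (h2 : y = x' \/ y = y') by (apply in_upair; rewrite <- h; apply in_upair; auto).
  assert (h3 : x' = x \/ x' = y) by (apply in_upair; rewrite h; apply in_upair; auto).
  assert (h4 : y' = x \/ y' = y) by (apply in_upair; rewrite h; apply in_upair; auto).
  intuition congruence.
Qed.

Lemma opair_inj x y x' y' : opair x y = opair x' y' -> x = x' /\ y = y'.
Proof.
  intros h; apply upair_inj in h.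
  destruct h as [[h1 h2]|[h1 h2]]; apply upair_inj in h1; apply upair_inj in h2;
    intuition congruence.
Qed.

(** * The natural numbers of V and well-foundedness *)

Lemma not_in_self (x : V) : ~ x ∈ x.
Proof.
  intros h; destruct (ax_foundation V (zfc_base V HV) (upair x x)) as [y [h1 h2]].
  - exists x; apply in_upair; auto.
  - apply in_upair in h1; assert (y = x) by tauto; subst.
    apply (h2 x); auto; apply in_upair; auto.
Qed.

Fixpoint num (n : nat) : V := match n with O => empty | S m => succ (num m) end.

Lemma num_lt m n : m < n -> num m ∈ num n.
Proof. induction 1; simpl; apply in_succ; auto. Qed.

Lemma num_inj m n : num m = num n -> m = n.
Proof.
  intros h; destruct (PeanoNat.Nat.lt_trichotomy m n) as [h1|[h1|h1]]; auto;
    apply num_lt in h1; rewrite h in h1; now apply not_in_self in h1.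
Qed.

Lemma inductive_num (w : V) n : inductive w -> num n ∈ w.
Proof.
  intros [[e [h1 h2]] h3]; induction n as [|n IH]; simpl.
  - replace empty with e; auto; apply set_ext; intros z; split; intros h.
    + now apply h1 in h.
    + now apply in_empty in h.
  - destruct (h3 _ IH) as [s [h4 h5]]; replace (succ (num n)) with s; auto.
    apply set_ext; intros z; rewrite in_succ; apply h4.
Qed.

(** Replacement holds for all relations of the metatheory, hence sequences indexed by its natural
numbers have sets of values in V. *)
Lemma natimg_ex (f : nat -> V) : exists y, forall b, b ∈ y <-> exists n, b = f n.
Proof.
  destruct (ax_infinity V (zfc_base V HV)) as [w hw].
  destruct (zfc_replacement V HV (fun a b => exists n, a = num n /\ b = f n) w) as [y hy].
  - intros a b c _ [n [h1 h2]] [m [h3 h4]]; subst.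
    apply num_inj in h3; now subst.
  - exists y; intros b; rewrite hy; split.
    + intros [a [_ [n [_ h]]]]; eauto.
    + intros [n h]; exists (num n); split; eauto; now apply inductive_num.
Qed.
Definition natimg (f : nat -> V) : V := chosen (natimg_ex f).
Lemma in_natimg f z : z ∈ natimg f <-> exists n, z = f n.
Proof. exact (chosenP (natimg_ex f) z). Qed.

Definition omega : V := natimg num.
Lemma in_omega z : z ∈ omega <-> exists n, z = num n.
Proof. apply in_natimg. Qed.

Lemma empty_is_empty : is_empty empty.
Proof. intros z; apply in_empty. Qed.

Lemma omega_inductive : inductive omega.
Proof.
  split.
  - exists empty; split; [apply empty_is_empty|apply in_omega; now exists 0].
  - intros x h; apply in_omega in h; destruct h as [n ->]; exists (succ (num n)); split.
    + intros z; apply in_succ.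
    + apply in_omega; now exists (S n).
Qed.

Lemma is_omega_eq w : is_omega w <-> w = omega.
Proof.
  assert (h0 : is_omega omega).
  { split; [apply omega_inductive|].
    intros v hv z h; apply in_omega in h; destruct h as [n ->]; now apply inductive_num. }
  split.
  - intros [h1 h2]; destruct h0 as [h3 h4].
    apply set_ext; intros z; split; [apply h2|apply h4]; auto.
  - now intros ->.
Qed.

Fixpoint unions (n : nat) (x : V) : V :=
  match n with O => x | S m => union (unions m x) end.
Definition trcl (x : V) : V := union (natimg (fun n => unions n x)).
Lemma in_trcl x z : z ∈ trcl x <-> exists n, z ∈ unions n x.
Proof.
  unfold trcl; rewrite in_union; split.
  - intros [y [h1 h2]]; apply in_natimg in h1; destruct h1 as [n ->]; eauto.
  - intros [n h]; exists (unions n x); split; auto; apply in_natimg; eauto.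
Qed.

Lemma trcl_trans x : transitive (trcl x).
Proof.
  intros y h z hz; apply in_trcl in h; destruct h as [n h]; apply in_trcl.
  exists (S n); simpl; apply in_union; eauto.
Qed.

Lemma sub_trcl x : x ⊆ trcl x.
Proof. intros z h; apply in_trcl; now exists 0. Qed.

Lemma trcl_min (x u : V) : x ⊆ u -> transitive u -> trcl x ⊆ u.
Proof.
  intros h1 h2 z hz; apply in_trcl in hz; destruct hz as [n hz]; revert z hz.
  induction n as [|n IH]; simpl; intros z hz; auto.
  apply in_union in hz; destruct hz as [y [h3 h4]].
  apply IH in h3; now apply (h2 y).
Qed.

Lemma is_trcl_eq x t : is_trcl x t <-> t = trcl x.
Proof.
  split.
  - intros (h1 & h2 & h3); apply set_ext; intros z; split.
    + apply h3; [apply sub_trcl|apply trcl_trans].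
    + now apply trcl_min.
  - intros ->; split; [apply sub_trcl|split; [apply trcl_trans|]].
    intros; now apply trcl_min.
Qed.

(** Separation for arbitrary predicates turns the foundation axiom into induction over all of V:
below a counterexample x, the failures inside the transitive closure of x form a set. *)
Lemma mem_ind (P : V -> Prop) :
  (forall x, (forall y, y ∈ x -> P y) -> P x) -> forall x, P x.
Proof.
  intros h x; apply NNPP; intros hx.
  destruct (ax_foundation V (zfc_base V HV)
    (sep (succ (trcl x)) (fun y => ~ forall z, z ∈ y -> P z)))  as [y [h1 h2]].
  - apply NNPP; intros h3.
    assert (h4 : forall y, y ∈ succ (trcl x) -> forall z, z ∈ y -> P z).
    { intros y hy; apply NNPP; intros h4; apply h3; exists y; now apply in_sep. }
    apply hx; apply h; intros y hy; apply (h4 (trcl x)).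
    + apply in_succ; auto.
    + now apply sub_trcl.
  - apply in_sep in h1; destruct h1 as [h1 h3]; apply h3; intros z hz; apply h.
    apply NNPP; intros h4; apply (h2 z); auto; apply in_sep; split; auto.
    apply in_succ; left; apply in_succ in h1; destruct h1 as [h1| ->]; auto.
    now apply (trcl_trans x y).
Qed.

Lemma mem_wf : well_founded (fun x y : carrier V => @mem V x y).
Proof. intros x; induction x using mem_ind; now constructor. Qed.

Lemma mem_min (P : V -> Prop) :
  (exists x, P x) -> exists x, P x /\ forall y, y ∈ x -> ~ P y.
Proof.
  intros [x h]; apply NNPP; intros h1; revert h.
  induction x as [x IH] using mem_ind; intros h; apply h1; exists x; split; auto.
Qed.

Lemma no_descent (f : nat -> V) : ~ forall n, f (S n) ∈ f n.
Proof.
  intros h.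
  enough (H : forall x n, x <> f n) by now apply (H (f 0) 0).
  intros x; induction x as [x IH] using mem_ind; intros n ->.
  now apply (IH (f (S n)) (h n) (S n)).
Qed.

Lemma no_cycle (x y : V) : x ∈ y -> y ∈ x -> False.
Proof.
  revert y; induction x as [x IH] using mem_ind; intros y h1 h2.
  now apply (IH y h2 x).
Qed.

Lemma sub_eq {M : V} (a b : sub M) : proj1_sig a = proj1_sig b -> a = b.
Proof.
  destruct a as [a ha], b as [b hb]; simpl; intros ->; f_equal; apply proof_irrelevance.
Qed.

(** * Ordinals *)

Lemma ord_in (a b : V) : ordinal a -> b ∈ a -> ordinal b.
Proof.
  intros [h1 h2] h; split.
  - intros y hy; revert y b hy h.
    (* What remains is a cycle z ∈ y ∈ b ∈ z. The induction hypothesis for z ∈ y gives z ⊆ y,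
       hence b ∈ y, a cycle of length two. *)
    intros y; induction y as [y IH] using mem_ind; intros b hy h z hz.
    assert (hy' : y ∈ a) by now apply (h1 b).
    assert (hz' : z ∈ a) by now apply (h1 y).
    destruct (h2 z b hz' h) as [h3|[h3|h3]]; auto.
    + subst; exfalso; now apply (no_cycle b y).
    + exfalso; apply (no_cycle y b hy).
      now apply (IH z hz y hz hy' b h3).
  - intros y z hy hz; apply h2; now apply (h1 b).
Qed.

Lemma ord_trans (a b c : V) : ordinal a -> c ∈ b -> b ∈ a -> c ∈ a.
Proof. intros [h _] h1 h2; now apply (h b). Qed.

Lemma ord_total (a b : V) : ordinal a -> ordinal b -> a ∈ b \/ a = b \/ b ∈ a.
Proof.
  revert b; induction a as [a IHa] using mem_ind; intros b.
  induction b as [b IHb] using mem_ind; intros ha hb.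
  destruct (classic (exists x, x ∈ a /\ ~ x ∈ b)) as [[x [h1 h2]]|h1].
  - destruct (IHa x h1 b) as [h|[h|h]]; auto; try tauto.
    + now apply (ord_in a).
    + subst; auto.
    + right; right; now apply (ord_trans a x).
  - destruct (classic (exists x, x ∈ b /\ ~ x ∈ a)) as [[x [h3 h4]]|h3].
    + destruct (IHb x h3) as [h|[h|h]]; auto; try tauto.
      * now apply (ord_in b).
      * left; now apply (ord_trans b x).
      * subst; auto.
    + right; left; apply set_ext; intros z; split; intros h; apply NNPP; intros h';
        [apply h1|apply h3]; eauto.
Qed.

Lemma ord_intro (a : V) : transitive a -> (forall x, x ∈ a -> ordinal x) -> ordinal a.
Proof. intros h1 h2; split; auto; intros y z hy hz; apply ord_total; auto. Qed.

Lemma ord_succ (a : V) : ordinal a -> ordinal (succ a).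
Proof.
  intros h; apply ord_intro.
  - intros x hx y hy; apply in_succ; left; apply in_succ in hx.
    destruct hx as [hx|hx]; subst; auto; now apply (ord_trans a x).
  - intros x hx; apply in_succ in hx; destruct hx as [hx|hx]; subst; auto.
    now apply (ord_in a).
Qed.

Lemma ord_union (x : V) : (forall a, a ∈ x -> ordinal a) -> ordinal (union x).
Proof.
  intros h; apply ord_intro.
  - intros a ha b hb; apply in_union in ha; destruct ha as [c [h1 h2]]; apply in_union.
    exists c; split; auto; apply (ord_trans c a); auto.
  - intros a ha; apply in_union in ha; destruct ha as [c [h1 h2]]; apply (ord_in c); auto.
Qed.

Lemma ord_empty : ordinal empty.
Proof. split; [intros y h|intros y z h]; now apply in_empty in h. Qed.

Lemma ord_num n : ordinal (num n).
Proof. induction n; simpl; [apply ord_empty|now apply ord_succ]. Qed.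

Lemma ord_omega : ordinal omega.
Proof.
  apply ord_intro.
  - intros x h y hy; apply in_omega in h; destruct h as [n ->]; apply in_omega.
    induction n as [|n IH]; simpl in hy; [now apply in_empty in hy|].
    apply in_succ in hy; destruct hy as [hy|hy]; eauto.
  - intros x h; apply in_omega in h; destruct h as [n ->]; apply ord_num.
Qed.

(** * Functions and bijections *)

Definition graph (x : V) (f : V -> V) : V := img x (fun a => opair a (f a)).

Lemma related_graph x f a b : related (graph x f) a b <-> a ∈ x /\ b = f a.
Proof.
  rewrite related_eq; unfold graph; rewrite in_img; split.
  - intros [c [h1 h2]]; apply opair_inj in h2; destruct h2; now subst.
  - intros [h1 h2]; exists a; now subst.
Qed.

Lemma graph_function x y f : (forall a, a ∈ x -> f a ∈ y) -> is_function (graph x f) x y.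
Proof.
  intros h; split.
  - intros p hp; apply in_img in hp; destruct hp as [a [h1 ->]].
    exists a, (f a); repeat split; auto; now apply is_opair_eq.
  - intros a ha; exists (f a); split.
    + now apply related_graph.
    + intros b hb; apply related_graph in hb; symmetry; tauto.
Qed.

Lemma function_graph (f x y : V) :
  is_function f x y -> exists g, (forall a, a ∈ x -> g a ∈ y) /\ f = graph x g.
Proof.
  intros [h1 h2].
  destruct (choice_on (fun a => a ∈ x) (fun a b => related f a b) empty) as [g hg].
  { intros a ha; destruct (h2 a ha) as [b [hb _]]; eauto. }
  exists g; split.
  - intros a ha; specialize (hg a ha); apply related_eq in hg; apply h1 in hg.
    destruct hg as (a' & b & h3 & h4 & h5); apply is_opair_eq in h5; apply opair_inj in h5.
    destruct h5; now subst.
  - apply set_ext; intros p; unfold graph; rewrite in_img; split.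
    + intros hp; destruct (h1 p hp) as (a & b & ha & hb & hab); apply is_opair_eq in hab; subst.
      exists a; split; auto; f_equal; destruct (h2 a ha) as [c [_ hc]].
      rewrite <- (hc b), <- (hc (g a)); auto; now apply related_eq.
    + intros [a [ha ->]]; apply related_eq; auto.
Qed.

Lemma equinumerous_intro (x y : V) (f : V -> V) :
  (forall a, a ∈ x -> f a ∈ y) ->
  (forall a b, a ∈ x -> b ∈ x -> f a = f b -> a = b) ->
  (forall b, b ∈ y -> exists a, a ∈ x /\ b = f a) -> equinumerous x y.
Proof.
  intros h1 h2 h3; exists (graph x f); split; [now apply graph_function|].
  intros b hb; destruct (h3 b hb) as [a [ha hab]]; exists a; split.
  - now apply related_graph.
  - intros a' ha'; apply related_graph in ha'; destruct ha'; apply h2; congruence.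
Qed.

Lemma equinumerous_elim (x y : V) : equinumerous x y -> exists f : V -> V,
  (forall a, a ∈ x -> f a ∈ y) /\
  (forall a b, a ∈ x -> b ∈ x -> f a = f b -> a = b) /\
  (forall b, b ∈ y -> exists a, a ∈ x /\ b = f a).
Proof.
  intros [g [h1 h2]]; destruct (function_graph _ _ _ h1) as [f [h3 ->]].
  exists f; split; [|split]; auto.
  - intros a b ha hb hab; destruct (h2 (f a)) as [c [_ hc]]; auto.
    rewrite <- (hc a), <- (hc b); auto; now apply related_graph.
  - intros b hb; destruct (h2 b hb) as [a [ha _]]; exists a; now apply related_graph.
Qed.

Definition injects (x y : V) : Prop := exists f : V -> V,
  (forall a, a ∈ x -> f a ∈ y) /\ (forall a b, a ∈ x -> b ∈ x -> f a = f b -> a = b).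

Lemma injects_sub (x y : V) : x ⊆ y -> injects x y.
Proof. intros h; exists (fun a => a); auto. Qed.

Lemma injects_trans x y z : injects x y -> injects y z -> injects x z.
Proof.
  intros [f [f1 f2]] [g [g1 g2]]; exists (fun a => g (f a)); split; auto.
Qed.

Lemma equinumerous_injects (x y : V) : equinumerous x y -> injects x y.
Proof. intros h; destruct (equinumerous_elim _ _ h) as [f [h1 [h2 _]]]; now exists f. Qed.

Lemma equinumerous_sym (x y : V) : equinumerous x y -> equinumerous y x.
Proof.
  intros h; destruct (equinumerous_elim _ _ h) as [f [h1 [h2 h3]]].
  destruct (choice_on (fun b => b ∈ y) (fun b a => a ∈ x /\ b = f a) empty h3) as [g hg].
  apply (equinumerous_intro y x g).
  - intros b hb; now apply hg.
  - intros a b ha hb hab; destruct (hg a ha), (hg b hb); congruence.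
  - intros a ha; exists (f a); split; auto.
    destruct (hg (f a)) as [h4 h5]; auto.
Qed.

(** The subset case of the Cantor-Bernstein theorem: apply f on the f-orbits that start in
y minus x, and leave the other points fixed. *)
Lemma bernstein_sub (x y : V) : x ⊆ y -> injects y x -> equinumerous y x.
Proof.
  intros hxy [f [f1 f2]].
  pose (C := fun z => exists n a, a ∈ y /\ ~ a ∈ x /\ z = Nat.iter n f a).
  pose (g := fun z => if excluded_middle_informative (C z) then f z else z).
  assert (Cf : forall z, C z -> C (f z)).
  { intros z (n & a & h1 & h2 & ->); exists (S n), a; auto. }
  assert (Cy : forall z, z ∈ y -> ~ z ∈ x -> C z).
  { intros z h1 h2; exists 0, z; auto. }
  apply (equinumerous_intro y x g); unfold g.
  - intros a ha; destruct (excluded_middle_informative (C a)); auto.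
    apply NNPP; intros h; auto.
  - intros a b ha hb.
    destruct (excluded_middle_informative (C a)), (excluded_middle_informative (C b));
      intros h; auto; subst; exfalso; auto.
  - intros b hb; destruct (classic (C b)) as [h|h].
    + destruct h as (n & a & h1 & h2 & h3); destruct n as [|n]; simpl in h3; [now subst|].
      assert (hc : Nat.iter n f a ∈ y).
      { clear h3; induction n; simpl; auto. }
      exists (Nat.iter n f a); split; auto.
      destruct (excluded_middle_informative (C (Nat.iter n f a))) as [_|h4]; auto.
      exfalso; apply h4; exists n, a; auto.
    + exists b; split; auto; destruct (excluded_middle_informative (C b)); tauto.
Qed.

Lemma cardinal_not_injects (k b : V) : cardinal k -> b ∈ k -> ~ injects k b.
Proof.
  intros [[h1 _] h2] h3 h4; apply (h2 b h3); apply equinumerous_sym.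
  apply bernstein_sub; auto.
Qed.

(** * Transfinite enumeration *)

Section Greedy.
Variables (X : Type) (rk : X -> V) (k : V).

Lemma greedy_pick (P : X -> Prop) :
  (exists x, P x) -> exists x, P x /\ forall y, P y -> ~ rk y ∈ rk x.
Proof.
  intros [x0 h0].
  destruct (mem_min (fun r => exists x, P x /\ r = rk x)) as [r [[x [h1 h2]] h3]]; eauto.
  exists x; split; auto; intros y hy h; subst; apply (h3 (rk y)); eauto.
Qed.

(** The value None records that nothing is left to enumerate. *)
Definition next (P : X -> Prop) : option X :=
  match excluded_middle_informative (exists x, P x) with
  | left h => Some (chosen (greedy_pick P h))
  | right _ => None
  end.

Definition greedy : V -> option X :=
  Fix mem_wf (fun _ => option X)
    (fun a g => next (fun x => forall b (hb : b ∈ a), g b hb <> Some x)).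

Lemma greedy_eq a : greedy a = next (fun x => forall b, b ∈ a -> greedy b <> Some x).
Proof.
  unfold greedy at 1; rewrite Fix_eq; [reflexivity|].
  intros c f g h; f_equal; apply functional_extensionality; intros x.
  apply propositional_extensionality; split; intros H b hb.
  - rewrite <- h; auto.
  - rewrite h; auto.
Qed.

Lemma greedy_some a x : greedy a = Some x ->
  (forall b, b ∈ a -> greedy b <> Some x) /\
  (forall y, (forall b, b ∈ a -> greedy b <> Some y) -> ~ rk y ∈ rk x).
Proof.
  rewrite greedy_eq; unfold next.
  destruct (excluded_middle_informative _) as [h|h]; [|discriminate].
  intros H; injection H as <-; exact (chosenP (greedy_pick _ h)).
Qed.

Lemma greedy_none a x : greedy a = None -> exists b, b ∈ a /\ greedy b = Some x.
Proof.
  rewrite greedy_eq; unfold next.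
  destruct (excluded_middle_informative _) as [h|h]; [discriminate|].
  intros _; apply NNPP; intros h'; apply h; exists x; intros b hb hbx; apply h'; eauto.
Qed.

(** Enumerate X along the ordinal k, always taking a new element of least rank. Either X is
exhausted at some stage below k, and is in bijection with an ordinal below k, or all of k is used.
In the second case an element that is never taken was available at every stage, so it has at least
the rank of each element taken. *)
Lemma enumeration : ordinal k ->
  (exists b (h : X -> V), b ∈ k /\ (forall x y, h x = h y -> x = y) /\
     (forall x, h x ∈ b) /\ forall i, i ∈ b -> exists x, h x = i) \/
  (exists g : sub k -> X, (forall i j, g i = g j -> i = j) /\
     forall x, (forall i, g i <> x) -> forall i, ~ rk x ∈ rk (g i)).
Proof.
  intros hk.
  assert (inj : forall a b x, ordinal a -> ordinal b ->
    greedy a = Some x -> greedy b = Some x -> a = b).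
  { intros a b x ha hb h1 h2; destruct (ord_total a b ha hb) as [h|[h|h]]; auto; exfalso.
    - now apply (proj1 (greedy_some b x h2) a).
    - now apply (proj1 (greedy_some a x h1) b). }
  destruct (classic (exists a, a ∈ k /\ greedy a = None)) as [h|h].
  - left; destruct (mem_min _ h) as [b [[h1 h2] h3]]; exists b.
    pose proof (fun x => greedy_none b x h2) as h4.
    exists (fun x => chosen (h4 x)); repeat split; auto.
    + intros x y hxy; pose proof (chosenP (h4 x)) as [_ hx].
      pose proof (chosenP (h4 y)) as [_ hy]; rewrite hxy in hx; congruence.
    + intros x; apply (chosenP (h4 x)).
    + intros i hi; destruct (greedy i) as [x|] eqn:e.
      * exists x; pose proof (chosenP (h4 x)) as [hx1 hx2].
        assert (hb : ordinal b) by now apply (ord_in k).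
        apply (inj _ _ x); auto; apply (ord_in b); auto.
      * exfalso; apply (h3 i hi); split; auto; now apply (ord_trans k b).
  - right.
    assert (h' : forall i : sub k, exists x, greedy (proj1_sig i) = Some x).
    { intros [i hi]; simpl; destruct (greedy i) as [x|] eqn:e; eauto; exfalso; eauto. }
    exists (fun i => chosen (h' i)); split.
    + intros i j hij; pose proof (chosenP (h' i)) as hi.
      pose proof (chosenP (h' j)) as hj; simpl in *; rewrite hij in hi.
      destruct i as [i pi], j as [j pj]; simpl in *.
      assert (i = j) by (apply (inj _ _ _ (ord_in k i hk pi) (ord_in k j hk pj) hi hj)).
      subst; f_equal; apply proof_irrelevance.
    + intros x hx i; apply (proj2 (greedy_some _ _ (chosenP (h' i)))).
      intros b hb hbx; assert (pb : b ∈ k).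
      { apply (ord_trans k (proj1_sig i)); auto; exact (proj2_sig i). }
      apply (hx (exist _ b pb)); pose proof (chosenP (h' (exist _ b pb))) as e; simpl in *.
      congruence.
Qed.
End Greedy.
(** * Normal measures *)

(** Measures act on predicates of the metatheory, which saves coding sets of ordinals. The last
clause replaces nonprincipality; in the presence of completeness it says that every singleton,
and then every initial segment of k, is null. *)
Record measure (k : V) (m : (V -> Prop) -> Prop) : Prop := {
  m_mono : forall P Q : V -> Prop, (forall x, x ∈ k -> P x -> Q x) -> m P -> m Q;
  m_ne : forall P, m P -> exists x, x ∈ k /\ P x;
  m_ultra : forall P, m P \/ m (fun x => ~ P x);
  m_complete : forall (b : V) (P : V -> V -> Prop), b ∈ k ->
    (forall i, i ∈ b -> m (P i)) -> m (fun x => forall i, i ∈ b -> P i x);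
  m_unif : forall b, b ∈ k -> m (fun x => b ∈ x)
}.

Lemma measurable_measure k : measurable k -> exists m, measure k m.
Proof.
  intros (hk & [w [hw1 hw2]] & U & (u1 & u2 & u3 & u4 & u5 & u6) & hc & hn).
  pose (m := fun P => sep k P ∈ U); exists m.
  assert (mono : forall P Q : V -> Prop, (forall x, x ∈ k -> P x -> Q x) -> m P -> m Q).
  { intros P Q h; unfold m; intros hP; apply (u4 (sep k P)); auto.
    - intros z; rewrite !in_sep; intros [h1 h2]; auto.
    - intros z; rewrite in_sep; tauto. }
  assert (ne : forall P, m P -> exists x, x ∈ k /\ P x).
  { intros P h; apply NNPP; intros h'; apply (u3 _ h); intros z hz; apply in_sep in hz; eauto. }
  assert (ultra : forall P, m P \/ m (fun x => ~ P x)).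
  { intros P; apply u6.
    - intros z; rewrite in_sep; tauto.
    - intros z; rewrite !in_sep; tauto. }
  assert (compl : forall (b : V) (P : V -> V -> Prop), b ∈ k ->
    (forall i, i ∈ b -> m (P i)) -> m (fun x => forall i, i ∈ b -> P i x)).
  { intros b P hb h; apply (hc (img b (fun i => sep k (P i)))).
    - intros z hz; apply in_img in hz; destruct hz as [i [hi ->]]; now apply h.
    (* The family F is the image of b, but completeness asks for a bijection with an ordinal below
       k. Otherwise k would inject into F, and by a choice of indices into b. *)
    - pose (F := img b (fun i => sep k (P i))); fold F.
      destruct (choice_on (fun z => z ∈ F) (fun z i => i ∈ b /\ z = sep k (P i)) empty)
        as [c hcs]; [intros z hz; now apply in_img|].
      destruct (enumeration (sub F) (fun _ => empty) k (proj1 hk))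
        as [(d & h' & h1 & h2 & h3 & h4)|[g [h1 _]]].
      + exists d; split; auto; apply equinumerous_sym.
        pose (f := fun i => match excluded_middle_informative (exists x, h' x = i) with
          | left p => proj1_sig (chosen p) | right _ => empty end).
        assert (hf : forall x, f (h' x) = proj1_sig x).
        { intros x; unfold f; destruct (excluded_middle_informative _) as [p|p].
          - f_equal; apply h2; apply (chosenP p).
          - exfalso; eauto. }
        apply (equinumerous_intro d F f).
        * intros i hi; destruct (h4 i hi) as [x <-]; rewrite hf; apply proj2_sig.
        * intros i j hi hj; destruct (h4 i hi) as [x <-]; destruct (h4 j hj) as [y <-].
          rewrite !hf; intros e; now apply sub_eq in e; subst.
        * intros z hz; exists (h' (exist _ z hz)); split; auto; now rewrite hf.
      + exfalso; apply (cardinal_not_injects k b hk hb).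
        exists (fun z => match excluded_middle_informative (z ∈ k) with
          | left p => c (proj1_sig (g (exist _ z p))) | right _ => empty end); split.
        * intros a ha; destruct (excluded_middle_informative _); [|tauto].
          apply hcs, proj2_sig.
        * intros i j hi hj; destruct (excluded_middle_informative (i ∈ k)),
            (excluded_middle_informative (j ∈ k)); try tauto; intros E.
          destruct (hcs (proj1_sig (g (exist _ i m0))) (proj2_sig (g (exist _ i m0)))) as [_ e1].
          destruct (hcs (proj1_sig (g (exist _ j m1))) (proj2_sig (g (exist _ j m1)))) as [_ e2].
          rewrite E, <- e2 in e1; apply sub_eq in e1; apply h1 in e1; congruence.
    - intros z; rewrite in_sep; split; intros [h1 h2]; split; auto.
      + intros X hX; apply in_img in hX; destruct hX as [i [hi ->]]; apply in_sep; auto.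
      + intros i hi; specialize (h2 _ (img_in b (fun i => sep k (P i)) i hi)).
        apply in_sep in h2; tauto. }
  assert (single : forall a, a ∈ k -> m (fun x => x <> a)).
  { intros a ha; destruct (ultra (fun x => x <> a)) as [h|h]; auto; exfalso; apply hn.
    exists a; split; auto; intros X; split.
    - intros hX; split; auto; apply NNPP; intros hX2.
      assert (h1 : sep k (fun x => x = a /\ x ∈ X) ∈ U).
      { apply (u5 X (sep k (fun x => ~ x <> a))); auto; intros z; rewrite !in_sep; split.
        - intros (h1 & -> & h2); repeat split; auto.
        - intros (h1 & h2 & h3); repeat split; auto; now apply NNPP. }
      apply (u3 _ h1); intros z hz; apply in_sep in hz; destruct hz as (_ & -> & hz); auto.
    - intros [h1 h2]; apply (u4 (sep k (fun x => ~ x <> a))); auto.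
      intros z hz; apply in_sep in hz; destruct hz as [_ hz]; apply NNPP in hz; now subst. }
  split; auto.
  intros b hb.
  assert (h1 : m (fun x => forall i, i ∈ b -> x <> i)).
  { apply compl; auto; intros i hi; apply single; apply (ord_trans k b); auto; apply hk. }
  pose proof (u5 _ _ (sep k (fun x => (forall i, i ∈ b -> x <> i) /\ x <> b)) h1 (single b hb)) as h2.
  apply (mono (fun x => (forall i, i ∈ b -> x <> i) /\ x <> b)).
  - intros x hx [h3 h4].
    destruct (ord_total x b (ord_in k x (proj1 hk) hx) (ord_in k b (proj1 hk) hb)) as [h|[h|h]];
      auto; [destruct (h3 x h eq_refl)|tauto].
  - apply h2; intros z; rewrite !in_sep; tauto.
Qed.

Section Measure.
Variables (k : V) (m : (V -> Prop) -> Prop).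
Hypotheses (k_ord : ordinal k) (k_omega : omega ∈ k) (hm : measure k m).

Lemma m_all (P : V -> Prop) : (forall x, x ∈ k -> P x) -> m P.
Proof.
  intros h; destruct (m_ultra k m hm P) as [h1|h1]; auto.
  apply (m_ne k m hm) in h1; destruct h1 as [x [h1 h2]]; destruct h2; auto.
Qed.

Lemma m_nat (P : nat -> V -> Prop) : (forall n, m (P n)) -> m (fun x => forall n, P n x).
Proof.
  intros h; apply (m_mono k m hm (fun x => forall i, i ∈ omega -> forall n, i = num n -> P n x)).
  - intros x hx h1 n; apply (h1 (num n)); auto; apply in_omega; eauto.
  - apply (m_complete k m hm _ (fun i x => forall n, i = num n -> P n x)); auto.
    intros i hi; apply in_omega in hi; destruct hi as [n ->].
    apply (m_mono k m hm (P n)); auto; intros x _ hx n' e; apply num_inj in e; now subst.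
Qed.

Lemma m_and (P Q : V -> Prop) : m P -> m Q -> m (fun x => P x /\ Q x).
Proof.
  intros hP hQ; apply (m_mono k m hm (fun x => forall n, match n with 0 => P x | _ => Q x end)).
  - intros x _ h; split; [apply (h 0)|apply (h 1)].
  - apply (m_nat (fun n x => match n with 0 => P x | _ => Q x end)); intros [|n]; auto.
Qed.

Lemma m_not (P : V -> Prop) : ~ m P -> m (fun x => ~ P x).
Proof. destruct (m_ultra k m hm P); tauto. Qed.

Lemma m_contra (P : V -> Prop) : m P -> m (fun x => ~ P x) -> False.
Proof.
  intros h1 h2; destruct (m_ne k m hm _ (m_and _ _ h1 h2)) as [x [_ h]]; tauto.
Qed.

Lemma m_exists {X : Type} (x0 : X) (R : V -> X -> Prop) :
  m (fun a => exists x, R a x) -> exists f, m (fun a => R a (f a)).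
Proof.
  intros h; destruct (choice_on (fun a => exists x, R a x) R x0) as [f hf]; auto.
  exists f; apply (m_mono k m hm _ _ (fun a _ => hf a) h).
Qed.

Lemma m_const_in (b : V) (g : V -> V) :
  b ∈ k -> m (fun a => g a ∈ b) -> exists i, i ∈ b /\ m (fun a => g a = i).
Proof.
  intros hb h; apply NNPP; intros h'.
  apply (m_contra _ h).
  apply (m_mono k m hm (fun a => forall i, i ∈ b -> g a <> i)).
  - intros a _ h1 h2; now apply (h1 (g a)).
  - apply (m_complete k m hm _ (fun i a => g a <> i)); auto.
    intros i hi; apply m_not; intros h1; apply h'; eauto.
Qed.

(** A measure-theoretic form of having size below k. It is used in place of cardinal arithmetic,
because it passes trivially to products, to functions on a small domain, and to inductive types. *)
Definition ae_constant (X : Type) : Prop := forall g : V -> X, exists x, m (fun a => g a = x).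

Lemma ae_constant_nat : ae_constant nat.
Proof.
  intros g; apply NNPP; intros h.
  destruct (m_ne k m hm (fun a => forall n, g a <> n)) as [a [_ h1]].
  - apply (m_nat (fun n a => g a <> n)); intros n; apply m_not; eauto.
  - now apply (h1 (g a)).
Qed.

Lemma ae_constant_inj {X Y : Type} (f : X -> Y) :
  (forall x y, f x = f y -> x = y) -> ae_constant Y -> ae_constant X.
Proof.
  intros hf hY g; destruct (hY (fun a => f (g a))) as [y hy].
  destruct (m_ne k m hm _ hy) as [a [_ <-]]; exists (g a).
  apply (m_mono k m hm _ _ (fun b _ => hf (g b) (g a)) hy).
Qed.

Lemma m_above (b : V) (f : V -> V) :
  b ∈ k -> (forall i, i ∈ b -> f i ∈ k) -> exists c, c ∈ k /\ forall i, i ∈ b -> f i ∈ c.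
Proof.
  intros hb hf; apply (m_ne k m hm (fun c => forall i, i ∈ b -> f i ∈ c)).
  apply (m_complete k m hm _ (fun i c => f i ∈ c)); auto.
  intros i hi; apply (m_unif k m hm); auto.
Qed.

(** An injection of k into X is not constant on any two points, so it is not almost everywhere
constant: this is how a smallness property bounds the size of X. *)
Lemma m_not_injective {X : Type} (x0 : X) (g : sub k -> X) :
  (forall f : V -> X, (forall z, z ∈ k -> exists i, f z = g i) ->
     exists x, m (fun a => f a = x)) ->
  exists i j, i <> j /\ g i = g j.
Proof.
  intros hg.
  pose (f := fun z => match excluded_middle_informative (z ∈ k) with
    | left p => g (exist _ z p) | right _ => x0 end).
  assert (hf : forall z p, f z = g (exist _ z p)).
  { intros z p; unfold f; destruct (excluded_middle_informative _); [|tauto].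
    repeat f_equal; apply proof_irrelevance. }
  destruct (hg f) as [i hi].
  { intros z hz; exists (exist _ z hz); auto. }
  destruct (m_ne k m hm _ hi) as [x [hx ex]].
  destruct (m_ne k m hm _ (m_and _ _ hi (m_unif k m hm x hx))) as [y [hy [ey hxy]]].
  exists (exist _ x hx), (exist _ y hy); split.
  - intros E; injection E as ->; now apply not_in_self in hxy.
  - now rewrite <- !hf, ex, ey.
Qed.
End Measure.

Definition normal (k : V) (m : (V -> Prop) -> Prop) : Prop :=
  forall g : V -> V, m (fun a => g a ∈ a) -> exists i, m (fun a => g a = i).

(** Among the functions d on k that are almost everywhere above each b < k, take one that is minimal
modulo m; it represents k in the ultrapower. The image of m under d is normal, because a function
below d modulo m is not above some b < k, hence almost everywhere at most b, hence constant almost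
everywhere. Minimal functions exist, as a descending sequence modulo m would give, at almost every
point, a descending sequence of ordinals. *)
Lemma normal_measure k m : ordinal k -> omega ∈ k -> measure k m ->
  exists nu, measure k nu /\ normal k nu.
Proof.
  intros ko kw hm.
  pose (good := fun d : V -> V => (forall x, x ∈ k -> d x ∈ k) /\
    forall b, b ∈ k -> m (fun x => b ∈ d x)).
  assert (hmin : exists d, good d /\ forall d', good d' -> ~ m (fun x => d' x ∈ d x)).
  { apply NNPP; intros h.
    assert (h1 : forall d, good d -> exists d', good d' /\ m (fun x => d' x ∈ d x)).
    { intros d hd; apply NNPP; intros h1; apply h; exists d; split; auto.
      intros d' hd' h2; apply h1; eauto. }
    destruct (choice_on good (fun d d' => good d' /\ m (fun x => d' x ∈ d x)) (fun x => x) h1)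
      as [F hF].
    pose (s := fun n => Nat.iter n F (fun x => x)).
    assert (hs : forall n, good (s n)).
    { induction n; simpl; [|now apply hF]; split; auto; apply (m_unif k m hm). }
    destruct (m_ne k m hm (fun x => forall n, s (S n) x ∈ s n x)) as [x [_ hx]].
    - apply (m_nat k m kw hm (fun n x => s (S n) x ∈ s n x)); intros n; now apply (hF (s n)).
    - now apply (no_descent (fun n => s n x)). }
  destruct hmin as [d [[d1 d2] d3]].
  exists (fun P => m (fun x => P (d x))); split; [split|].
  - intros P Q h; apply (m_mono k m hm); auto.
  - intros P h; destruct (m_ne k m hm _ h) as [x [h1 h2]]; eauto.
  - intros P; apply (m_ultra k m hm).
  - intros b P hb h; apply (m_complete k m hm b (fun i x => P i (d x)) hb h).
  - auto.
  - intros g hg.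
    pose (d' := fun x => if excluded_middle_informative (g (d x) ∈ d x) then g (d x) else empty).
    assert (h0 : empty ∈ k).
    { apply (ord_trans k omega); auto; apply in_omega; now exists 0. }
    assert (d1' : forall x, x ∈ k -> d' x ∈ k).
    { intros x hx; unfold d'; destruct (excluded_middle_informative _); auto.
      apply (ord_trans k (d x)); auto. }
    assert (hb : exists b, b ∈ k /\ ~ m (fun x => b ∈ d' x)).
    { apply NNPP; intros h; apply (d3 d').
      - split; auto; intros b hb; apply NNPP; intros h1; eauto.
      - apply (m_mono k m hm (fun x => g (d x) ∈ d x)); auto; intros x _ hx; unfold d'.
        now destruct (excluded_middle_informative _). }
    destruct hb as [b [hb1 hb2]].
    assert (fin : forall i, m (fun x => d' x = i) -> exists i, m (fun x => g (d x) = i)).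
    { intros i hi; exists i; apply (m_mono k m hm (fun x => d' x = i /\ g (d x) ∈ d x)).
      - intros x _ [hx1 hx2]; unfold d' in hx1.
        now destruct (excluded_middle_informative _).
      - now apply (m_and k m kw hm). }
    destruct (m_ultra k m hm (fun x => d' x = b)) as [h|h]; eauto.
    destruct (m_const_in k m kw hm b d' hb1) as [i [_ hi]]; eauto.
    apply (m_mono k m hm (fun x => ~ d' x = b /\ ~ b ∈ d' x)).
    + intros x hx [h1 h2].
      destruct (ord_total (d' x) b) as [h3|[h3|h3]]; auto; try tauto; apply (ord_in k); auto.
    + apply (m_and k m kw hm); auto; now apply (m_not k m hm).
Qed.
(** * The sets H(theta) *)

Lemma set_recursion (R : V -> V -> Prop) (pred : V -> V) (G : V -> V) :
  well_founded R -> (forall a b, a ∈ pred b -> R a b) ->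
  exists f : V -> V, forall x, f x = G (img (pred x) f).
Proof.
  intros wf hp.
  pose (step := fun b (g : forall a, R a b -> V) => G (img (pred b) (fun a =>
    match excluded_middle_informative (R a b) with
    | left h => g a h | right _ => empty end))).
  exists (Fix wf (fun _ => carrier V) step); intros x; rewrite Fix_eq.
  - unfold step at 1; f_equal; apply set_ext; intros z; rewrite !in_img.
    split; intros [a [h1 h2]]; exists a; split; auto;
      destruct (excluded_middle_informative (R a x)) as [h|h]; auto; destruct (h (hp _ _ h1)).
  - intros b g g' h; unfold step; f_equal; apply set_ext; intros z; rewrite !in_img.
    split; intros [a [h1 h2]]; exists a; split; auto;
      destruct (excluded_middle_informative (R a b)); auto; rewrite h2, h; auto.
Qed.

(** The Mostowski collapse of a well-ordering of x. *)
Lemma numeration (x : V) : exists d, ordinal d /\ injects x d /\ injects d x.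
Proof.
  destruct (ax_choice V (zfc_base V HV) x) as [r (h1 & h2 & h3 & h4)].
  pose (R := fun a b => a ∈ x /\ b ∈ x /\ related r a b).
  assert (wf : well_founded R).
  { intros b; apply NNPP; intros hb.
    destruct (h4 (sep x (fun a => ~ Acc R a))) as [y [hy1 hy2]].
    - intros z hz; apply in_sep in hz; tauto.
    - exists b; apply in_sep; split; auto; apply NNPP; intros hx; apply hb.
      constructor; intros a [_ [ha _]]; tauto.
    - apply in_sep in hy1; destruct hy1 as [hyx hy1]; apply hy1; constructor.
      intros a [ha1 [_ ha2]]; apply NNPP; intros ha3; destruct (hy2 a) as [h5|h5].
      + now apply in_sep.
      + subst; now apply (h1 a).
      + apply (h1 a ha1); now apply (h2 a y a). }
  destruct (set_recursion R (fun b => sep x (fun a => R a b)) (fun s => s) wf) as [f hf].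
  { intros a b h; apply in_sep in h; tauto. }
  assert (hin : forall b z, z ∈ f b <-> exists a, R a b /\ z = f a).
  { intros b z; rewrite hf, in_img; split; intros [a [h5 h6]]; exists a; split; auto.
    - apply in_sep in h5; tauto.
    - apply in_sep; split; auto; apply h5. }
  assert (htr : forall a b c, R a b -> R b c -> R a c).
  { intros a b c [ha [hb hab]] [_ [hc hbc]]; repeat split; auto; now apply (h2 a b c). }
  assert (hord : forall b, ordinal (f b)).
  { intros b; induction b as [b IH] using (well_founded_ind wf); apply ord_intro.
    - intros y hy z hz; apply hin in hy; destruct hy as [a [ha ->]]; apply hin in hz.
      destruct hz as [c [hc ->]]; apply hin; exists c; split; auto; now apply (htr c a b).
    - intros y hy; apply hin in hy; destruct hy as [a [ha ->]]; auto. }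
  assert (hinj : forall a b, a ∈ x -> b ∈ x -> f a = f b -> a = b).
  { intros a b ha hb hab; destruct (h3 a b ha hb) as [h|[h|h]]; auto; exfalso;
      apply (not_in_self (f a)).
    - rewrite hab at 2; apply hin; exists a; now repeat split.
    - rewrite hab at 1; apply hin; exists b; now repeat split. }
  exists (img x f); split; [|split].
  - apply ord_intro.
    + intros y hy z hz; apply in_img in hy; destruct hy as [a [ha ->]]; apply hin in hz.
      destruct hz as [c [hc ->]]; apply img_in; apply hc.
    + intros y hy; apply in_img in hy; destruct hy as [a [ha ->]]; auto.
  - exists f; split; auto; intros a ha; now apply img_in.
  - destruct (choice_on (fun b => b ∈ img x f) (fun b a => a ∈ x /\ b = f a) empty) as [g hg].
    { intros b hb; now apply in_img. }
    exists g; split.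
    + intros b hb; apply (hg b hb).
    + intros a b ha hb hab; destruct (hg a ha), (hg b hb); congruence.
Qed.

Lemma cantor (x : V) : ~ injects (power x) x.
Proof.
  intros [f [h1 h2]].
  pose (D := sep x (fun y => exists z, z ⊆ x /\ y = f z /\ ~ y ∈ z)).
  assert (hD : D ⊆ x) by (intros z hz; apply in_sep in hz; tauto).
  assert (hn : ~ f D ∈ D).
  { intros h; pose proof h as h'; apply in_sep in h'; destruct h' as [_ (z & h3 & h4 & h5)].
    apply h2 in h4; try (now apply in_power); now subst. }
  apply hn; apply in_sep; split; [apply h1; now apply in_power|]; eauto.
Qed.

(** The regular cardinals used here are the Hartogs numbers of sets Y that are closed under ordered
pairs. Then being smaller than theta amounts to injecting into Y, and a union of few small sets
injects into Y by sending an element to the pair of its place in the family and its place in that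
member. *)
Section Theta.
Variable Y : V.
Hypothesis Y_opair : forall x y, x ∈ Y -> y ∈ Y -> opair x y ∈ Y.
Hypothesis Y_omega : omega ⊆ Y.

(** An ordinal that does not inject into Y exists because the power set of Y is equinumerous with
an ordinal. *)
Lemma theta_ex : exists t, (ordinal t /\ ~ injects t Y) /\
  forall a, a ∈ t -> ~ (ordinal a /\ ~ injects a Y).
Proof.
  apply mem_min; destruct (numeration (power Y)) as (d & h1 & h2 & _).
  exists d; split; auto; intros h; apply (cantor Y); now apply (injects_trans _ d).
Qed.

Definition theta : V := chosen theta_ex.

Lemma theta_ord : ordinal theta.
Proof. apply (proj1 (chosenP theta_ex)). Qed.

Lemma in_theta a : a ∈ theta <-> ordinal a /\ injects a Y.
Proof.
  pose proof (chosenP theta_ex) as [[h1 h2] h3]; fold theta in *; split.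
  - intros h; split; [now apply (ord_in theta)|]; apply NNPP; intros h4.
    apply (h3 a h); split; auto; now apply (ord_in theta).
  - intros [ha h]; destruct (ord_total a theta) as [h4|[h4|h4]]; auto.
    + now subst.
    + exfalso; apply h2; apply (injects_trans _ a); auto; apply injects_sub.
      now apply (proj1 ha).
Qed.

Lemma smaller_theta x : smaller x theta <-> injects x Y.
Proof.
  split.
  - intros [b [h1 h2]]; apply in_theta in h1; apply (injects_trans _ b); [|tauto].
    now apply equinumerous_injects.
  - intros hx.
    destruct (enumeration (sub x) (fun _ => empty) theta theta_ord)
      as [(b & h & h1 & h2 & h3 & h4)|[g [h1 _]]].
    + exists b; split; auto.
      pose (f := fun z => match excluded_middle_informative (z ∈ x) with
        | left p => h (exist _ z p) | right _ => empty end).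
      assert (hf : forall z p, f z = h (exist _ z p)).
      { intros z p; unfold f; destruct (excluded_middle_informative _); [|tauto].
        repeat f_equal; apply proof_irrelevance. }
      apply (equinumerous_intro x b f).
      * intros a p; rewrite (hf a p); auto.
      * intros a a' p p'; rewrite (hf a p), (hf a' p'); intros e; apply h2 in e; congruence.
      * intros i hi; destruct (h4 i hi) as [[z p] <-]; exists z; split; auto.
    + exfalso; apply (proj2 (proj1 (chosenP theta_ex))); fold theta.
      apply (injects_trans _ x); auto.
      exists (fun z => match excluded_middle_informative (z ∈ theta) with
        | left p => proj1_sig (g (exist _ z p)) | right _ => empty end); split.
      * intros a ha; destruct (excluded_middle_informative _); [|tauto]. apply proj2_sig.
      * intros a b ha hb; destruct (excluded_middle_informative (a ∈ theta)),
          (excluded_middle_informative (b ∈ theta)); try tauto.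
        intros e; apply sub_eq in e; apply h1 in e; congruence.
Qed.

Lemma injects_img x f : injects x Y -> injects (img x f) Y.
Proof.
  intros h; destruct (choice_on (fun b => b ∈ img x f) (fun b a => a ∈ x /\ b = f a) empty)
    as [g hg].
  { intros b hb; now apply in_img. }
  apply (injects_trans _ x); auto; exists g; split.
  - intros b hb; apply (hg b hb).
  - intros a b ha hb hab; destruct (hg a ha), (hg b hb); congruence.
Qed.

Lemma injects_union x f :
  injects x Y -> (forall i, i ∈ x -> injects (f i) Y) -> injects (union (img x f)) Y.
Proof.
  intros [e [e1 e2]] h.
  destruct (choice_on (fun i => i ∈ x) (fun i (g : V -> V) =>
     (forall a, a ∈ f i -> g a ∈ Y) /\
     (forall a b, a ∈ f i -> b ∈ f i -> g a = g b -> a = b)) (fun a => a) h) as [g hg].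
  destruct (choice_on (fun z => z ∈ union (img x f)) (fun z i => i ∈ x /\ z ∈ f i) empty)
    as [c hc].
  { intros z hz; apply in_union in hz; destruct hz as [y [h1 h2]]; apply in_img in h1.
    destruct h1 as [i [h1 ->]]; eauto. }
  exists (fun z => opair (e (c z)) (g (c z) z)); split.
  - intros z hz; destruct (hc z hz); apply Y_opair; auto; now apply hg.
  - intros z z' hz hz' E; apply opair_inj in E; destruct E as [E1 E2].
    destruct (hc z hz) as [h1 h2], (hc z' hz') as [h3 h4]; apply e2 in E1; auto.
    rewrite <- E1 in *; now apply (proj2 (hg _ h1)).
Qed.

Lemma injects_upair a b : injects (upair a b) Y.
Proof.
  exists (fun z => if excluded_middle_informative (z = a) then num 0 else num 1); split.
  - intros z _; destruct (excluded_middle_informative _); apply Y_omega; apply in_omega; eauto.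
  - intros z z' h1 h2; apply in_upair in h1; apply in_upair in h2.
    destruct (excluded_middle_informative (z = a)), (excluded_middle_informative (z' = a));
      intros E; try (apply num_inj in E; discriminate); destruct h1, h2; congruence.
Qed.

Lemma injects_cup a b : injects a Y -> injects b Y -> injects (cup a b) Y.
Proof.
  intros ha hb; replace (cup a b) with (union (img (upair a b) (fun z => z))).
  - apply injects_union; [apply injects_upair|].
    intros i hi; apply in_upair in hi; destruct hi; now subst.
  - unfold cup; f_equal; apply set_ext; intros z; rewrite in_img; split.
    + now intros [i [h ->]].
    + eauto.
Qed.

Lemma injects_succ a : injects a Y -> injects (succ a) Y.
Proof. intros h; apply injects_cup; auto; apply injects_upair. Qed.

Lemma injects_omega : injects omega Y.
Proof. now apply injects_sub. Qed.

Lemma theta_regular : regular theta.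
Proof.
  split; [split; [apply theta_ord|]|split].
  - intros b hb h; apply in_theta in hb; apply (proj2 (proj1 (chosenP theta_ex))); fold theta.
    apply (injects_trans _ b); [|tauto]; now apply equinumerous_injects, equinumerous_sym.
  - exists omega; split; [now apply is_omega_eq|].
    assert (h : omega ∈ theta) by (apply in_theta; split; [apply ord_omega|apply injects_omega]).
    now apply (proj1 theta_ord).
  - intros b f hb hf; apply function_graph in hf; destruct hf as [g [hg ->]].
    exists (union (img b (fun i => succ (g i)))); split.
    + apply in_theta in hb; apply in_theta; split.
      * apply ord_union; intros a ha; apply in_img in ha; destruct ha as [i [hi ->]].
        apply ord_succ; apply (ord_in theta); auto; apply theta_ord.
      * apply injects_union; [tauto|]; intros i hi; apply injects_succ.
        specialize (hg i hi); apply in_theta in hg; tauto.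
    + intros x y h; apply related_graph in h; destruct h as [h ->]; apply in_union.
      exists (succ (g x)); split; [now apply (img_in b (fun i => succ (g i)))|].
      apply in_succ; auto.
Qed.

Lemma mem_recursion (G : V -> V) : exists f : V -> V, forall x, f x = G (img x f).
Proof.
  apply (set_recursion (fun x y => x ∈ y) (fun x => x)); auto; apply mem_wf.
Qed.

(** The sets with small transitive closure form a set: the ranks of the elements of a transitive
closure exhaust the rank of the set, which is therefore an ordinal injecting into Y. So these sets
all lie in level theta of the cumulative hierarchy. *)
Lemma H_ex : exists H, forall x, x ∈ H <-> injects (trcl x) Y.
Proof.
  destruct (mem_recursion (fun s => union (img s succ))) as [rk hrk].
  destruct (mem_recursion (fun s => union (img s power))) as [L hL].
  assert (rkin : forall x z, z ∈ rk x <-> exists y, y ∈ x /\ (z ∈ rk y \/ z = rk y)).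
  { intros x z; rewrite hrk, in_union; split.
    - intros [u [h1 h2]]; apply in_img in h1; destruct h1 as [v [h1 ->]].
      apply in_img in h1; destruct h1 as [y [h1 ->]]; apply in_succ in h2; eauto.
    - intros [y [h1 h2]]; exists (succ (rk y)); split; [|now apply in_succ].
      now apply img_in, img_in. }
  assert (Lin : forall x z, z ∈ L x <-> exists y, y ∈ x /\ z ⊆ L y).
  { intros x z; rewrite hL, in_union; split.
    - intros [u [h1 h2]]; apply in_img in h1; destruct h1 as [v [h1 ->]].
      apply in_img in h1; destruct h1 as [y [h1 ->]]; apply in_power in h2; eauto.
    - intros [y [h1 h2]]; exists (power (L y)); split; [|now apply in_power].
      now apply img_in, img_in. }
  assert (rkord : forall x, ordinal (rk x)).
  { intros x; induction x as [x IH] using mem_ind; rewrite hrk; apply ord_union.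
    intros a ha; apply in_img in ha; destruct ha as [b [hb ->]]; apply in_img in hb.
    destruct hb as [y [hy ->]]; apply ord_succ; auto. }
  assert (rktrcl : forall x, rk x ⊆ img (trcl x) rk).
  { intros x; induction x as [x IH] using mem_ind; intros z hz; apply rkin in hz.
    destruct hz as [y [hy [hz|hz]]].
    - apply (IH y hy) in hz; apply in_img in hz; destruct hz as [a [ha ->]]; apply img_in.
      revert a ha; apply trcl_min; [|apply trcl_trans].
      apply (trcl_trans x); now apply sub_trcl.
    - subst; apply img_in; now apply sub_trcl. }
  assert (Lsub : forall x, x ⊆ L (rk x)).
  { intros x; induction x as [x IH] using mem_ind; intros y hy; apply Lin.
    exists (rk y); split; auto; apply rkin; eauto. }
  exists (sep (power (L theta)) (fun x => injects (trcl x) Y)); intros x.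
  rewrite in_sep; split; [tauto|]; intros h; split; auto; apply in_power.
  assert (hx : rk x ∈ theta).
  { apply in_theta; split; auto; apply (injects_trans _ (img (trcl x) rk)).
    - now apply injects_sub.
    - now apply injects_img. }
  intros z hz; apply Lsub in hz; apply Lin in hz; destruct hz as [y [h1 h2]]; apply Lin.
  exists y; split; auto; apply (ord_trans theta (rk x)); auto; apply theta_ord.
Qed.

Definition H : V := chosen H_ex.
Lemma in_H x : x ∈ H <-> injects (trcl x) Y.
Proof. apply (chosenP H_ex). Qed.

Lemma H_is_H : is_H theta H.
Proof.
  intros x; rewrite in_H, <- smaller_theta; split.
  - intros h; exists (trcl x); split; auto; now apply is_trcl_eq.
  - intros [t [h1 h2]]; apply is_trcl_eq in h1; now subst.
Qed.

Lemma H_trans x y : x ∈ H -> y ∈ x -> y ∈ H.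
Proof.
  rewrite !in_H; intros h hy; apply (injects_trans _ (trcl x)); auto; apply injects_sub.
  apply trcl_min; [|apply trcl_trans]; apply (trcl_trans x); now apply sub_trcl.
Qed.

Lemma H_small x : x ∈ H -> injects x Y.
Proof.
  rewrite in_H; intros h; apply (injects_trans _ (trcl x)); auto; apply injects_sub, sub_trcl.
Qed.

(** Closure of H under pairing, union and replacement comes from this: a subset of H that injects
into Y has a transitive closure that does so too. *)
Lemma H_intro x : (forall y, y ∈ x -> y ∈ H) -> injects x Y -> x ∈ H.
Proof.
  intros h1 h2; apply in_H.
  apply (injects_trans _ (cup x (union (img x trcl)))).
  - apply injects_sub, trcl_min.
    + intros y hy; apply in_cup; auto.
    + intros y hy z hz; apply in_cup; right; apply in_union; apply in_cup in hy.
      destruct hy as [hy|hy].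
      * exists (trcl y); split; [now apply img_in|]; now apply sub_trcl.
      * apply in_union in hy; destruct hy as [t [ht hy]]; exists t; split; auto.
        apply in_img in ht; destruct ht as [u [hu ->]]; now apply (trcl_trans u y).
  - apply injects_cup; auto; apply injects_union; auto.
    intros i hi; now apply in_H, h1.
Qed.

Lemma H_sub x y : x ∈ H -> y ⊆ x -> y ∈ H.
Proof.
  intros h1 h2; apply H_intro.
  - intros z hz; apply (H_trans x); auto.
  - apply (injects_trans _ x); [now apply injects_sub|now apply H_small].
Qed.

Lemma H_upair x y : x ∈ H -> y ∈ H -> upair x y ∈ H.
Proof.
  intros hx hy; apply H_intro; [|apply injects_upair].
  intros z hz; apply in_upair in hz; destruct hz; now subst.
Qed.

Lemma H_opair x y : x ∈ H -> y ∈ H -> opair x y ∈ H.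
Proof. intros hx hy; apply H_upair; now apply H_upair. Qed.

Lemma H_union x f : x ∈ H -> (forall y, y ∈ x -> f y ∈ H) -> union (img x f) ∈ H.
Proof.
  intros h1 h2; apply H_intro.
  - intros y hy; apply in_union in hy; destruct hy as [z [hz hy]]; apply in_img in hz.
    destruct hz as [a [ha ->]]; apply (H_trans (f a)); auto.
  - apply injects_union; [now apply H_small|]; intros i hi; now apply H_small, h2.
Qed.

Lemma H_img x f : injects x Y -> (forall y, y ∈ x -> f y ∈ H) -> img x f ∈ H.
Proof.
  intros h1 h2; apply H_intro; [|now apply injects_img].
  intros y hy; apply in_img in hy; destruct hy as [a [ha ->]]; auto.
Qed.

Lemma H_ord a : ordinal a -> injects a Y -> a ∈ H.
Proof.
  intros h1 h2; apply in_H; apply (injects_trans _ a); auto; apply injects_sub, trcl_min.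
  - intros z; auto.
  - apply h1.
Qed.

Lemma H_graph b f : b ∈ H -> (forall i, i ∈ b -> f i ∈ H) -> graph b f ∈ H.
Proof.
  intros h1 h2; apply H_img; [now apply H_small|].
  intros y hy; apply H_opair; auto; now apply (H_trans b).
Qed.

Lemma related_H (r x y : sub H) : related r x y <-> related (proj1_sig r) (proj1_sig x) (proj1_sig y).
Proof.
  rewrite related_eq; split.
  - intros (p & (a & b & h1 & h2 & h3) & h4).
    assert (e0 : forall x y p : sub H, is_upair x y p -> proj1_sig p = upair (proj1_sig x) (proj1_sig y)).
    { clear; intros x y p h; apply set_ext; intros z; rewrite in_upair; split.
      - intros hz; destruct (proj1 (h (exist _ z (H_trans _ _ (proj2_sig p) hz))) hz); subst; auto.
      - intros [hz|hz]; subst; apply h; auto. }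
    apply e0 in h1; apply e0 in h2; apply e0 in h3; rewrite h1, h2 in h3.
    unfold opair; rewrite <- h3; exact h4.
  - intros h.
    assert (e0 : forall (x y : sub H) hp, 
      is_upair x y (exist _ (upair (proj1_sig x) (proj1_sig y)) hp : sub H)).
    { clear; intros x y hp z; simpl; rewrite in_upair; split; intros [h|h]; subst; auto;
        [left|right]; now apply sub_eq. }
    destruct x as [x hx], y as [y hy]; simpl in *.
    exists (exist (fun z => z ∈ H) (opair x y) (H_opair x y hx hy)); split; [|exact h].
    exists (exist (fun z => z ∈ H) (upair x x) (H_upair x x hx hx)),
      (exist _ (upair x y) (H_upair x y hx hy)).
    split; [apply (e0 (exist _ x hx) (exist _ x hx))|split].
    + apply (e0 (exist _ x hx) (exist _ y hy)).
    + apply (e0 (exist _ (upair x x) _) (exist _ (upair x y) _)).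
Qed.

Lemma H_ZFCminus : ZFCminus (sub H).
Proof.
  assert (sepH : forall (x : sub H) (P : sub H -> Prop),
    exists y : sub H, forall z, z ∈ y <-> z ∈ x /\ P z).
  { intros [x hx] P.
    assert (hy : sep x (fun z => exists p : z ∈ H, P (exist _ z p)) ∈ H).
    { apply (H_sub x); auto; intros z hz; apply in_sep in hz; tauto. }
    exists (exist (fun z => z ∈ H) _ hy); intros [z hz]; simpl; rewrite in_sep; split.
    - intros [h1 [p h2]]; split; auto; now rewrite (proof_irrelevance _ hz p).
    - intros [h1 h2]; split; auto; now exists hz. }
  split; [split|..].
  - intros [x hx] [y hy] h; apply sub_eq; simpl; apply set_ext; intros z; split; intros hz.
    + apply (h (exist _ z (H_trans x z hx hz))); exact hz.
    + apply (h (exist _ z (H_trans y z hy hz))); exact hz.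
  - intros [x hx] [[y hy] h].
    destruct (ax_foundation V (zfc_base V HV) x) as [z [h1 h2]]; [exists y; exact h|].
    exists (exist (fun z => z ∈ H) z (H_trans x z hx h1)); split; auto.
    intros [t ht] h3; simpl; auto.
  - intros [x hx] [y hy]; exists (exist (fun z => z ∈ H) (upair x y) (H_upair x y hx hy)).
    intros [z hz]; simpl; rewrite in_upair; split; intros [h|h];
      [left|right|left|right]; try (now apply sub_eq); now injection h.
  - intros [x hx].
    exists (exist (fun z => z ∈ H) _ (H_union x (fun z => z) hx (fun y => H_trans x y hx))).
    intros [z hz]; simpl; rewrite in_union; split.
    + intros [y [h1 h2]]; apply in_img in h1; destruct h1 as [y' [h1 ->]].
      exists (exist (fun z => z ∈ H) y' (H_trans x y' hx h1)); split; auto.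
    + intros [[y hy] [h1 h2]]; exists y; split; auto.
      now apply (img_in x (fun z => z)).
  - exists (exist (fun z => z ∈ H) omega (H_ord _ ord_omega injects_omega)); split.
    + assert (he : empty ∈ omega) by (apply in_omega; now exists 0).
      exists (exist (fun z => z ∈ H) empty (H_trans _ _ (H_ord _ ord_omega injects_omega) he));
        split; auto.
      intros z; apply in_empty.
    + intros [x hx] h; simpl in h.
      assert (hs : succ x ∈ omega).
      { apply in_omega in h; destruct h as [n ->]; apply in_omega; now exists (S n). }
      exists (exist (fun z => z ∈ H) (succ x) (H_trans _ _ (H_ord _ ord_omega injects_omega) hs));
        split; auto.
      intros [z hz]; simpl; rewrite in_succ; split; intros [h1|h1]; auto; right;
        [now apply sub_eq|now injection h1].
  - intros [x hx]; destruct (ax_choice V (zfc_base V HV) x) as [r hr].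
    pose (r' := sep (union (img x (fun a => img x (fun b => opair a b)))) (fun p => p ∈ r)).
    assert (hr' : r' ∈ H).
    { apply (H_sub (union (img x (fun a => img x (fun b => opair a b))))).
      - apply H_union; auto; intros y hy; apply H_img; [now apply H_small|].
        intros z hz; apply H_opair; now apply (H_trans x).
      - intros z hz; apply in_sep in hz; tauto. }
    assert (e : forall a b, a ∈ x -> b ∈ x -> related r' a b <-> related r a b).
    { intros a b ha hb; rewrite !related_eq; unfold r'; rewrite in_sep; split; [tauto|].
      intros h; split; auto; apply in_union.
      exists (img x (fun b => opair a b)); split.
      - now apply (img_in x (fun a => img x (fun b => opair a b))).
      - now apply (img_in x (fun b => opair a b)). }
    destruct hr as (r1 & r2 & r3 & r4).
    exists (exist (fun z => z ∈ H) r' hr'); split; [|split; [|split]].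
    + intros [y hy] h; rewrite related_H; simpl in *; rewrite e; auto.
    + intros [y hy] [z hz] [t ht] h1 h2 h3; rewrite !related_H; simpl in *; rewrite !e; auto.
      now apply r2.
    + intros [y hy] [z hz] h1 h2; rewrite !related_H; simpl in *; rewrite !e; auto.
      destruct (r3 y z h1 h2) as [h|[h|h]]; auto; right; left; now apply sub_eq.
    + intros [u hu] h [[y0 hy0] h0]; simpl in h0.
      assert (hux : u ⊆ x).
      { intros z hz; apply (h (exist _ z (H_trans u z hu hz))); exact hz. }
      destruct (r4 u hux) as [y [h1 h2]]; [eauto|].
      exists (exist (fun z => z ∈ H) y (H_trans u y hu h1)); split; [exact h1|].
      intros [z hz] h3; simpl in h3; rewrite related_H; simpl; rewrite e; auto.
      destruct (h2 z h3); auto; left; now apply sub_eq.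
  - intros p s x; apply (sepH x (fun z => sat p (scons z s))).
  - intros p s [x hx] h.
    destruct (choice_on (fun a => a ∈ x) (fun a b => exists (ha : a ∈ H) (hb : b ∈ H),
      sat p (scons (exist _ a ha : sub H) (scons (exist _ b hb : sub H) s))) empty) as [f hf].
    { intros a ha; destruct (h (exist _ a (H_trans x a hx ha)) ha) as [[b hb] h1].
      exists b, (H_trans x a hx ha), hb; exact h1. }
    assert (hy : img x f ∈ H).
    { apply H_img; [now apply H_small|]; intros y hy; now destruct (hf y hy) as (_ & h1 & _). }
    exists (exist (fun z => z ∈ H) _ hy); intros [a ha] h1; destruct (hf a h1) as (ha' & hb & h2).
    exists (exist (fun z => z ∈ H) (f a) hb); split; [now apply img_in|].
    now rewrite (proof_irrelevance _ ha ha').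
Qed.
(** * Terms *)

Section Terms.
Variables (k : V) (nu : (V -> Prop) -> Prop).
Hypotheses (k_ord : ordinal k) (k_omega : omega ∈ k) (k_Y : k ⊆ Y).
Hypotheses (hnu : measure k nu) (hnorm : normal k nu).
Variable A : V -> V.
Hypothesis hA : forall a, a ∈ k -> A a ⊆ a.

Inductive label :=
| gen | ident | const | skolem (p : formula) | sequence | up | low | lim.

(** All operations have arities below k and take their arguments as a family indexed by the arity,
so that one constructor covers finitary operations, Skolem functions with an infinite sequence of
parameters, and sequences of any length below k. *)
Inductive term := node (l : label) (b : sub k) (s : sub (proj1_sig b) -> term).

Fixpoint code (p : formula) : nat :=
  match p with
  | f_mem i j => Cantor.to_nat (0, Cantor.to_nat (i, j))
  | f_eq i j => Cantor.to_nat (1, Cantor.to_nat (i, j))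
  | f_bot => Cantor.to_nat (2, 0)
  | f_imp p q => Cantor.to_nat (3, Cantor.to_nat (code p, code q))
  | f_all p => Cantor.to_nat (4, code p)
  end.

Lemma code_inj p q : code p = code q -> p = q.
Proof.
  revert q; induction p as [i j|i j| |p IHp p' IHp'|p IHp]; intros [i'' j''|i'' j''| |q q'|q];
    cbn [code]; intros h; apply Cantor.to_nat_inj, pair_equal_spec in h; destruct h as [h h1];
    try discriminate h; auto;
    try (apply Cantor.to_nat_inj, pair_equal_spec in h1; destruct h1); f_equal; auto.
Qed.

Definition label_code (l : label) : nat :=
  match l with
  | gen => 0 | ident => 1 | const => 2 | sequence => 3 | up => 4 | low => 5 | lim => 6
  | skolem p => 7 + code p
  end.

Lemma ae_constant_label : ae_constant nu label.
Proof.
  apply (ae_constant_inj k nu hnu label_code); [|now apply (ae_constant_nat k nu k_omega hnu)].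
  intros [| | |p| | | |] [| | |q| | | |]; simpl; intros h; try discriminate; auto.
  injection h as h; f_equal; now apply code_inj.
Qed.

Lemma k_zero : empty ∈ k.
Proof. apply (ord_trans k omega); auto; apply in_omega; now exists 0. Qed.

Definition mk (l : label) (b : sub k) (s : V -> term) : term :=
  node l b (fun i => s (proj1_sig i)).

Definition leaf (l : label) : term :=
  node l (exist _ empty k_zero) (fun i => match in_empty _ (proj2_sig i) with end).

Definition root (t : term) : label := match t with node l _ _ => l end.
Definition arity (t : term) : V := match t with node _ b _ => proj1_sig b end.
Definition child (t : term) (i : V) : term :=
  match t with node _ b s =>
    match excluded_middle_informative (i ∈ proj1_sig b) with
    | left p => s (exist _ i p) | right _ => leaf gen end end.

Lemma child_node l b s i p : child (node l b s) i = s (exist _ i p).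
Proof.
  simpl; destruct (excluded_middle_informative _); [|tauto].
  repeat f_equal; apply proof_irrelevance.
Qed.

Lemma term_ext t t' : root t = root t' -> arity t = arity t' ->
  (forall i, i ∈ arity t -> child t i = child t' i) -> t = t'.
Proof.
  destruct t as [l b s], t' as [l' b' s']; simpl root; simpl arity; intros <- hb h.
  apply sub_eq in hb; subst b'; f_equal; apply functional_extensionality; intros [i p].
  rewrite <- (child_node l b s i p), <- (child_node l b s' i p); auto.
Qed.

(** An upper bound for the height and the arities occurring in a term. It is used in place of a rank
function because no suprema are needed to define it. *)
Fixpoint bounded (t : term) (d : V) : Prop :=
  match t with node _ b s =>
    exists e, e ∈ d /\ proj1_sig b ∈ e /\ forall i, bounded (s i) e end.

Lemma bounded_mono t d d' : ordinal d' -> d ∈ d' -> bounded t d -> bounded t d'.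
Proof.
  destruct t as [l b s]; simpl; intros h1 h2 [e [h3 h4]]; exists e; split; auto.
  now apply (ord_trans d' d).
Qed.

(** A measure on k leaves room above fewer than k many ordinals below k. *)
Lemma bounded_ex t : exists d, d ∈ k /\ bounded t d.
Proof.
  induction t as [l b s IH].
  destruct (choice_on (fun i => i ∈ proj1_sig b)
    (fun i d => forall p, d ∈ k /\ bounded (s (exist _ i p)) d) empty) as [f hf].
  { intros i p; destruct (IH (exist _ i p)) as [d hd]; exists d; intros p'.
    now rewrite (proof_irrelevance _ p' p). }
  destruct (m_ne k nu hnu (fun e => proj1_sig b ∈ e /\ forall i, i ∈ proj1_sig b -> f i ∈ e))
    as [e [he [h1 h2]]].
  { apply (m_and k nu k_omega hnu); [apply (m_unif k nu hnu), proj2_sig|].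
    apply (m_complete k nu hnu _ (fun i e => f i ∈ e)); [apply proj2_sig|].
    intros i hi; apply (m_unif k nu hnu); now apply hf. }
  destruct (m_ne k nu hnu _ (m_unif k nu hnu e he)) as [d [hd hed]].
  exists d; split; auto; exists e; split; auto; split; auto.
  intros [i p]; apply (bounded_mono _ (f i)); auto; [now apply (ord_in k)|now apply hf].
Qed.

Lemma const_of_family {X : Type} (g : V -> X) (S : V -> Prop) :
  nu S -> (forall a a', S a -> S a' -> g a = g a') -> exists x, nu (fun a => g a = x).
Proof.
  intros hS h; destruct (m_ne k nu hnu S hS) as [a [_ ha]]; exists (g a).
  now apply (m_mono k nu hnu S); auto.
Qed.

(** The terms below a bound are few. By induction on the bound: label and arity of the term chosen
at a are constant almost everywhere, so is each child, and by completeness all children at once. *)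
Lemma bounded_const d : d ∈ k -> forall g : V -> term,
  nu (fun a => bounded (g a) d) -> exists t, nu (fun a => g a = t).
Proof.
  induction d as [d IH] using mem_ind; intros hd g hg.
  destruct (m_exists k nu hnu empty (fun a e => e ∈ d /\ arity (g a) ∈ e /\
    forall i, i ∈ arity (g a) -> bounded (child (g a) i) e)) as [f hf].
  { apply (m_mono k nu hnu _ _) with (2 := hg); intros a _ h; destruct (g a) as [l b s].
    destruct h as (e & h1 & h2 & h3); exists e; repeat split; auto.
    intros i p; rewrite (child_node l b s i p); auto. }
  destruct (m_const_in k nu k_omega hnu d f hd) as [e [he1 he2]].
  { apply (m_mono k nu hnu _ _) with (2 := hf); tauto. }
  assert (hek : e ∈ k) by now apply (ord_trans k d).
  pose proof (m_and k nu k_omega hnu _ _ hf he2) as h1.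
  destruct (m_const_in k nu k_omega hnu e (fun a => arity (g a)) hek) as [b [hb1 hb2]].
  { apply (m_mono k nu hnu _ _) with (2 := h1); intros a _ [h <-]; tauto. }
  assert (hbk : b ∈ k) by now apply (ord_trans k e).
  destruct (ae_constant_label (fun a => root (g a))) as [l hl].
  pose proof (m_and k nu k_omega hnu _ _ h1 hb2) as h2.
  destruct (choice_on (fun i => i ∈ b) (fun i t => nu (fun a => child (g a) i = t)) (leaf gen))
    as [s hs].
  { intros i hi; apply (IH e he1 hek (fun a => child (g a) i)).
    apply (m_mono k nu hnu _ _) with (2 := h2); intros a _ [[h <-] E].
    apply h; now rewrite E. }
  apply (const_of_family g (fun a => (root (g a) = l /\ arity (g a) = b) /\
    forall i, i ∈ b -> child (g a) i = s i)).
  - repeat apply (m_and k nu k_omega hnu); auto.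
    now apply (m_complete k nu hnu b (fun i a => child (g a) i = s i)).
  - intros a a' [[h3 h4] h5] [[h6 h7] h8]; apply term_ext; try congruence.
    intros i hi; rewrite h4 in hi; now rewrite h5, h8.
Qed.

(** A greedy enumeration of the terms by increasing least bound leaves no term t out: otherwise all
of k would be spent on terms that are no higher than t, against [bounded_const]. *)
Lemma index_ex : exists idx : term -> V,
  (forall t, idx t ∈ k) /\ (forall t t', idx t = idx t' -> t = t').
Proof.
  assert (hr : forall t, exists d, (d ∈ k /\ bounded t d) /\
    forall e, e ∈ d -> ~ (e ∈ k /\ bounded t e)).
  { intros t; apply mem_min, bounded_ex. }
  pose (rk := fun t => chosen (hr t)).
  assert (hrk : forall t, rk t ∈ k /\ bounded t (rk t)).
  { intros t; apply (proj1 (chosenP (hr t))). }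
  destruct (enumeration term rk k k_ord) as [(b & h & h1 & h2 & h3 & _)|[g [h1 h2]]].
  - exists h; split; auto; intros t; now apply (ord_trans k b).
  - assert (h3 : forall t, exists i, g i = t).
    { intros t; apply NNPP; intros ht.
      destruct (m_not_injective k nu k_omega hnu t g) as (i & j & h3 & h4); auto.
      intros f hf.
      destruct (m_ne k nu hnu _ (m_unif k nu hnu _ (proj1 (hrk t)))) as [d [hd1 hd2]].
      apply (bounded_const d hd1 f); apply (m_all k nu hnu); intros z hz.
      destruct (hf z hz) as [i ->]; apply (bounded_mono _ (rk (g i))).
      - now apply (ord_in k).
      - destruct (ord_total (rk (g i)) d) as [h3|[h3|h3]]; auto;
          try (apply (ord_in k); auto; apply hrk); exfalso; apply (h2 t) with (i := i);
          try (intros j hj; apply ht; eauto).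
        + now rewrite h3.
        + apply (ord_trans _ d); auto; apply (ord_in k); auto; apply hrk.
      - apply hrk. }
    exists (fun t => proj1_sig (chosen (h3 t))); split.
    + intros t; apply proj2_sig.
    + intros t t' e; apply sub_eq in e.
      rewrite <- (chosenP (h3 t)), <- (chosenP (h3 t')); now f_equal.
Qed.

Definition idx : term -> V := chosen index_ex.
Lemma idx_k t : idx t ∈ k.
Proof. apply (proj1 (chosenP index_ex)). Qed.
Lemma idx_inj t t' : idx t = idx t' -> t = t'.
Proof. apply (proj2 (chosenP index_ex)). Qed.

(** The pressing down lemma for terms, on which [closed_ae] and [truth_ae] rest. *)
Lemma normal_term (g : V -> term) :
  nu (fun a => idx (g a) ∈ a) -> exists t, nu (fun a => g a = t).
Proof.
  intros h; destruct (hnorm (fun a => idx (g a)) h) as [c hc].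
  apply (const_of_family g (fun a => idx (g a) = c)); auto.
  intros a a' h1 h2; apply idx_inj; congruence.
Qed.

(** * Evaluation of terms *)

Lemma k_H a : a ∈ k -> a ∈ H.
Proof.
  intros h; apply H_ord; [now apply (ord_in k)|]; apply injects_sub.
  intros z hz; apply k_Y; now apply (ord_trans k a).
Qed.

Lemma dflt_ex : exists x : sub H, True.
Proof. now exists (exist (fun z => z ∈ H) empty (k_H _ k_zero)). Qed.
Definition dflt : sub H := chosen dflt_ex.

Definition toH (x : V) : sub H :=
  match excluded_middle_informative (x ∈ H) with
  | left p => exist _ x p | right _ => dflt end.

Lemma toH_val x : x ∈ H -> proj1_sig (toH x) = x.
Proof. intros h; unfold toH; now destruct (excluded_middle_informative _). Qed.

Definition witness (p : formula) (s : nat -> sub H) : sub H :=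
  match excluded_middle_informative (exists x, sat p (scons x s)) with
  | left h => chosen h | right _ => dflt end.

Lemma witnessP p s : (exists x, sat p (scons x s)) -> sat p (scons (witness p s) s).
Proof.
  intros h; unfold witness; destruct (excluded_middle_informative _) as [h'|]; [|tauto].
  exact (chosenP h').
Qed.

Definition value_at (b : V) (v : sub b -> V -> V -> sub H) (i x y : V) : sub H :=
  match excluded_middle_informative (i ∈ b) with
  | left p => v (exist _ i p) x y | right _ => dflt end.

(** The operations on functions of two ordinals. At a pair (x, y), the first ordinal x is where the
model is evaluated and y > x is where its image under the embedding is evaluated. The
model consists of diagonal values, so [up] and [low] are the two ways to turn a diagonal value into a
value at (x, y). The operation [lim] takes the subset of x to which the values at (x, z) converge
as z runs through almost all ordinals; it makes the measure amenable to the models. *)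
Definition op (l : label) (b : V) (v : sub b -> V -> V -> sub H) (x y : V) : sub H :=
  match l with
  | gen => toH (A x)
  | ident => toH x
  | const => toH b
  | skolem p => witness p (fun n => value_at b v (num n) x y)
  | sequence => toH (graph b (fun i => proj1_sig (value_at b v i x y)))
  | up => value_at b v (num 0) y y
  | low => value_at b v (num 0) x x
  | lim => toH (sep x (fun i => nu (fun z => i ∈ proj1_sig (value_at b v (num 0) x z))))
  end.

Fixpoint ev (t : term) : V -> V -> sub H :=
  match t with node l b s => op l (proj1_sig b) (fun i => ev (s i)) end.

(** * Good ordinals *)

(** The last two clauses are closure of the terms of index below a under all operations of arity
below a, and agreement of their diagonal values at a with the ultrapower: what holds at a is what
holds almost everywhere. *)
Definition good (a : V) : Prop :=
  a ∈ k /\ omega ∈ a /\ regular a /\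
  (forall (l : label) (b : sub k) (s : V -> term), proj1_sig b ∈ a ->
     (forall i, i ∈ proj1_sig b -> idx (s i) ∈ a) -> idx (mk l b s) ∈ a) /\
  (forall (p : formula) (s : nat -> term), (forall n, idx (s n) ∈ a) ->
     (sat p (fun n => ev (s n) a a) <-> nu (fun z => sat p (fun n => ev (s n) z z)))).

(** A cofinal function into a from some b < a is regressive in each of its values, so if such
functions exist for almost every a, one and the same function f on a fixed b serves for almost
every a. Its values are bounded by some c < k, which is below almost every a. Regularity in this
sense already rules out a bijection between a and a smaller ordinal. *)
Lemma regular_ae : nu regular.
Proof.
  assert (h : nu (fun a => forall (b : V) (f : V -> V), b ∈ a -> (forall i, i ∈ b -> f i ∈ a) ->
    exists c, c ∈ a /\ forall i, i ∈ b -> f i ∈ c)).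
  { apply NNPP; intros h; apply (m_not k nu hnu) in h.
    destruct (m_exists k nu hnu (empty, fun x : V => x) (fun a bf => fst bf ∈ a /\
      (forall i, i ∈ fst bf -> snd bf i ∈ a) /\
      ~ exists c, c ∈ a /\ forall i, i ∈ fst bf -> snd bf i ∈ c)) as [g hg].
    { apply (m_mono k nu hnu _ _) with (2 := h); intros a _ h1.
      apply NNPP; intros h2; apply h1; intros b f hb hf; apply NNPP; intros h3.
      apply h2; exists (b, f); auto. }
    destruct (hnorm (fun a => fst (g a))) as [b hb].
    { apply (m_mono k nu hnu _ _) with (2 := hg); tauto. }
    pose proof (m_and k nu k_omega hnu _ _ hg hb) as h1.
    assert (hbk : b ∈ k).
    { destruct (m_ne k nu hnu _ h1) as [a [ha [h2 <-]]]; now apply (ord_trans k a). }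
    destruct (choice_on (fun i => i ∈ b) (fun i c => nu (fun a => snd (g a) i = c)) empty)
      as [C hC].
    { intros i hi; apply (hnorm (fun a => snd (g a) i)).
      apply (m_mono k nu hnu _ _) with (2 := h1); intros a _ [h2 <-]; now apply h2. }
    destruct (m_above k nu hnu b C hbk) as [c [hc1 hc2]].
    { intros i hi; destruct (m_ne k nu hnu _ (m_and k nu k_omega hnu _ _ h1 (hC i hi)))
        as [a [ha [[h2 <-] <-]]]; apply (ord_trans k a); auto; now apply h2. }
    destruct (m_ne k nu hnu _ (m_and k nu k_omega hnu _ _
      (m_complete k nu hnu b (fun i a => snd (g a) i = C i) hbk hC)
      (m_and k nu k_omega hnu _ _ h1 (m_unif k nu hnu c hc1)))) as [a [_ [h2 [[h3 h4] h5]]]].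
    apply h3; exists c; split; auto; rewrite h4; intros i hi; rewrite h2; auto. }
  apply (m_mono k nu hnu _ _) with (2 := m_and k nu k_omega hnu _ _ h (m_unif k nu hnu _ k_omega)).
  intros a ha [h1 h2].
  assert (ao : ordinal a) by now apply (ord_in k).
  split; [split; auto|split].
  - intros b hb hba; apply equinumerous_elim in hba; destruct hba as [f [f1 [_ f2]]].
    destruct (h1 b f hb f1) as [c [hc1 hc2]]; destruct (f2 c hc1) as [i [hi hci]].
    apply hc2 in hi; rewrite <- hci in hi; now apply not_in_self in hi.
  - exists omega; split; [now apply is_omega_eq|]; now apply ao.
  - intros b f hb hf; apply function_graph in hf; destruct hf as [g [hg ->]].
    destruct (h1 b g hb hg) as [c [hc1 hc2]]; exists c; split; auto.
    intros x y hxy; apply related_graph in hxy; destruct hxy as [hx ->]; auto.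
Qed.

(** If it failed, then a fixed term mk l b s would have its index at least a for almost every a. *)
Lemma closed_ae : nu (fun a => forall (l : label) (b : sub k) (s : V -> term), proj1_sig b ∈ a ->
  (forall i, i ∈ proj1_sig b -> idx (s i) ∈ a) -> idx (mk l b s) ∈ a).
Proof.
  apply NNPP; intros h; apply (m_not k nu hnu) in h.
  destruct (m_exists k nu hnu (gen, (exist _ empty k_zero : sub k), fun _ : V => leaf gen)
    (fun a lbs => proj1_sig (snd (fst lbs)) ∈ a /\
      (forall i, i ∈ proj1_sig (snd (fst lbs)) -> idx (snd lbs i) ∈ a) /\
      ~ idx (mk (fst (fst lbs)) (snd (fst lbs)) (snd lbs)) ∈ a)) as [g hg].
  { apply (m_mono k nu hnu _ _) with (2 := h); intros a _ h1.
    apply NNPP; intros h2; apply h1; intros l b s hb hs; apply NNPP; intros h3.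
    apply h2; exists (l, b, s); auto. }
  destruct (hnorm (fun a => proj1_sig (snd (fst (g a))))) as [b hb].
  { apply (m_mono k nu hnu _ _) with (2 := hg); tauto. }
  pose proof (m_and k nu k_omega hnu _ _ hg hb) as h1.
  assert (hbk : b ∈ k).
  { destruct (m_ne k nu hnu _ hb) as [a [_ <-]]; apply proj2_sig. }
  destruct (ae_constant_label (fun a => fst (fst (g a)))) as [l hl].
  destruct (choice_on (fun i => i ∈ b) (fun i t => nu (fun a => snd (g a) i = t)) (leaf gen))
    as [s hs].
  { intros i hi; apply (normal_term (fun a => snd (g a) i)).
    apply (m_mono k nu hnu _ _) with (2 := h1); intros a _ [h2 <-]; now apply h2. }
  pose (b' := exist _ b hbk : sub k).
  destruct (m_ne k nu hnu _ (m_and k nu k_omega hnu _ _ (m_and k nu k_omega hnu _ _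
      (m_complete k nu hnu b (fun i a => snd (g a) i = s i) hbk hs) hl)
      (m_and k nu k_omega hnu _ _ h1 (m_unif k nu hnu _ (idx_k (mk l b' s))))))
    as [a [_ [[h2 h3] [[h4 h5] h6]]]].
  apply h4; replace (mk _ _ _) with (mk l b' s); auto.
  rewrite h3; assert (e : snd (fst (g a)) = b') by now apply sub_eq.
  rewrite e; unfold mk; f_equal; apply functional_extensionality; intros [i hi]; simpl.
  now rewrite h2.
Qed.

(** If it failed, it would fail almost everywhere for a fixed formula and a fixed sequence of terms,
for which it is the statement that nu is an ultrafilter. *)
Lemma truth_ae : nu (fun a => forall (p : formula) (s : nat -> term), (forall n, idx (s n) ∈ a) ->
     (sat p (fun n => ev (s n) a a) <-> nu (fun z => sat p (fun n => ev (s n) z z)))).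
Proof.
  apply NNPP; intros h; apply (m_not k nu hnu) in h.
  destruct (m_exists k nu hnu (f_bot, fun _ : nat => leaf gen)
    (fun a ps => (forall n, idx (snd ps n) ∈ a) /\
      ~ (sat (fst ps) (fun n => ev (snd ps n) a a) <->
         nu (fun z => sat (fst ps) (fun n => ev (snd ps n) z z))))) as [g hg].
  { apply (m_mono k nu hnu _ _) with (2 := h); intros a _ h1.
    apply NNPP; intros h2; apply h1; intros p s hs; apply NNPP; intros h3.
    apply h2; exists (p, s); auto. }
  destruct (ae_constant_inj k nu hnu code code_inj (ae_constant_nat k nu k_omega hnu)
    (fun a => fst (g a)))
    as [p hp].
  destruct (choice_on (fun _ : nat => True) (fun n t => nu (fun a => snd (g a) n = t)) (leaf gen))
    as [s hs].
  { intros n _; apply (normal_term (fun a => snd (g a) n)).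
    apply (m_mono k nu hnu _ _) with (2 := hg); intros a _ h2; now apply h2. }
  assert (h1 : nu (fun a => ~ (sat p (fun n => ev (s n) a a) <->
    nu (fun z => sat p (fun n => ev (s n) z z))))).
  { apply (m_mono k nu hnu _ _) with (2 := m_and k nu k_omega hnu _ _
      (m_and k nu k_omega hnu _ _ hg hp)
      (m_nat k nu k_omega hnu (fun n a => snd (g a) n = s n) (fun n => hs n I))).
    intros a _ [[[_ h1] h2] h3]; rewrite h2 in h1.
    replace (snd (g a)) with s in h1; auto; apply functional_extensionality; auto. }
  destruct (m_ultra k nu hnu (fun z => sat p (fun n => ev (s n) z z))) as [h2|h2];
    destruct (m_ne k nu hnu _ (m_and k nu k_omega hnu _ _ h1 h2)) as [a [_ [h3 h4]]];
    apply h3; split; try tauto.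
  intros h5; exfalso; apply (m_contra k nu k_omega hnu _ h5 h2).
Qed.

Lemma good_ae : nu good.
Proof.
  apply (m_and k nu k_omega hnu); [now apply (m_all k nu hnu)|].
  apply (m_and k nu k_omega hnu); [now apply (m_unif k nu hnu)|].
  apply (m_and k nu k_omega hnu); [apply regular_ae|].
  apply (m_and k nu k_omega hnu); [apply closed_ae|apply truth_ae].
Qed.

(** The traces on a of the values at (a, b) have reached their limits. *)
Definition limit_good (a b : V) : Prop := forall t i, idx t ∈ a -> i ∈ a ->
  (i ∈ proj1_sig (ev t a b) <-> nu (fun z => i ∈ proj1_sig (ev t a z))).

Lemma limit_good_ae a : a ∈ k -> nu (limit_good a).
Proof.
  intros ha.
  apply (m_mono k nu hnu (fun b => forall c, c ∈ a -> forall i, i ∈ a -> forall t, idx t = c ->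
     (i ∈ proj1_sig (ev t a b) <-> nu (fun z => i ∈ proj1_sig (ev t a z))))).
  { intros b _ h t i ht hi; now apply (h (idx t)). }
  apply (m_complete k nu hnu a (fun c b => forall i, i ∈ a -> forall t, idx t = c ->
     (i ∈ proj1_sig (ev t a b) <-> nu (fun z => i ∈ proj1_sig (ev t a z))))); auto.
  intros c hc.
  apply (m_complete k nu hnu a (fun i b => forall t, idx t = c ->
     (i ∈ proj1_sig (ev t a b) <-> nu (fun z => i ∈ proj1_sig (ev t a z))))); auto.
  intros i hi; destruct (classic (exists t, idx t = c)) as [[t ht]|h].
  - destruct (m_ultra k nu hnu (fun z => i ∈ proj1_sig (ev t a z))) as [h|h];
      apply (m_mono k nu hnu _ _) with (2 := h); intros b _ hb t' ht';
      assert (t' = t) by (apply idx_inj; congruence); subst t'; split; auto; try tauto.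
    intros h'; destruct (m_contra k nu k_omega hnu _ h' h).
  - apply (m_all k nu hnu); intros b _ t ht; destruct h; eauto.
Qed.

(** * The models *)

Definition hull (a b : V) : V :=
  sep H (fun z => exists t, idx t ∈ a /\ z = proj1_sig (ev t a b)).

Lemma in_hull a b z : z ∈ hull a b <-> exists t, idx t ∈ a /\ z = proj1_sig (ev t a b).
Proof.
  unfold hull; rewrite in_sep; split; [tauto|]; intros [t [h1 ->]]; split; eauto.
  apply proj2_sig.
Qed.

Lemma hull_H a b z : z ∈ hull a b -> z ∈ H.
Proof. intros h; apply in_sep in h; tauto. Qed.

Definition incl {a b : V} (x : sub (hull a b)) : sub H :=
  exist (fun z => z ∈ H) (proj1_sig x) (hull_H a b _ (proj2_sig x)).

Lemma good_mk a l (b : V) (s : V -> term) : good a -> b ∈ a ->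
  (forall i, i ∈ b -> idx (s i) ∈ a) -> exists t, idx t ∈ a /\
  forall x y, ev t x y = op l b (fun i => ev (s (proj1_sig i))) x y.
Proof.
  intros (h1 & h2 & h3 & h4 & h5) hb hs.
  pose (b' := exist _ b (ord_trans k a b k_ord hb h1) : sub k).
  exists (mk l b' s); split; [now apply h4|reflexivity].
Qed.

Lemma good_unary a l t : good a -> idx t ∈ a -> exists t', idx t' ∈ a /\
  forall x y, ev t' x y = op l omega (fun _ => ev t) x y.
Proof. intros ha ht; apply (good_mk a l omega (fun _ => t)); auto; apply ha. Qed.

Lemma hull_witness a b p (s : nat -> sub H) : good a -> (forall n, proj1_sig (s n) ∈ hull a b) ->
  proj1_sig (witness p s) ∈ hull a b.
Proof.
  intros ha hs.
  assert (hs' : forall n, exists t, idx t ∈ a /\ s n = ev t a b).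
  { intros n; destruct (proj1 (in_hull _ _ _) (hs n)) as [t [h1 h2]]; exists t; split; auto.
    now apply sub_eq. }
  (* The arguments of a Skolem term are indexed by the set omega, those of a formula by the natural
     numbers of the metatheory. *)
  pose (un := fun i => match excluded_middle_informative (exists n, i = num n) with
    | left h => chosen h | right _ => 0 end).
  assert (hun : forall n, un (num n) = n).
  { intros n; unfold un; destruct (excluded_middle_informative _) as [h|h].
    - symmetry; apply num_inj, (chosenP h).
    - destruct h; eauto. }
  destruct (good_mk a (skolem p) omega (fun i => chosen (hs' (un i)))) as [t [h1 h2]]; auto.
  { apply ha. }
  { intros i _; apply (chosenP (hs' (un i))). }
  apply in_hull; exists t; split; auto; rewrite h2; simpl; do 2 f_equal.
  apply functional_extensionality; intros n; unfold value_at.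
  destruct (excluded_middle_informative (num n ∈ omega)) as [p0|p0]; simpl.
  - rewrite hun; apply (chosenP (hs' n)).
  - destruct p0; apply in_omega; eauto.
Qed.

(** The Tarski-Vaught test; a counterexample to a universal formula is a witness of its negation. *)
Lemma hull_elementary a b : good a -> elementary (@incl a b).
Proof.
  intros ha p; induction p as [i j|i j| |p IHp q IHq|p IHp]; intros s; simpl; try tauto.
  - split; intros h; [now rewrite h|]; apply sub_eq; now injection h.
  - now rewrite IHp, IHq.
  - split.
    + intros h x; apply NNPP; intros hx.
      pose (w := witness (f_imp p f_bot) (fun n => incl (s n))).
      assert (hw : proj1_sig w ∈ hull a b).
      { apply hull_witness; auto; intros n; exact (proj2_sig (s n)). }
      assert (h1 : sat (f_imp p f_bot) (scons w (fun n => incl (s n)))).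
      { apply witnessP; now exists x. }
      apply h1; specialize (h (exist (fun z => z ∈ hull a b) _ hw)); apply IHp in h.
      rewrite scons_map in h.
      replace w with (incl (exist (fun z => z ∈ hull a b) _ hw : sub (hull a b))); auto; now apply sub_eq.
    + intros h x; apply IHp; rewrite scons_map; apply h.
Qed.

Lemma const_term a i : good a -> i ∈ a -> exists t, idx t ∈ a /\
  forall x y, proj1_sig (ev t x y) = i.
Proof.
  intros ha hi; pose proof ha as (ak & _ & _ & hc & _).
  assert (hz : empty ∈ a).
  { apply (ord_trans a omega); [now apply (ord_in k)| |apply ha].
    apply in_omega; now exists 0. }
  assert (hik : i ∈ k) by now apply (ord_trans k a).
  destruct (good_mk a gen empty (fun _ => leaf gen) ha hz) as [t0 [h0 _]].
  { intros j hj; now apply in_empty in hj. }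
  destruct (good_mk a const i (fun _ => t0) ha hi) as [t [h1 h2]]; auto.
  exists t; split; auto; intros x y; rewrite h2; simpl; now apply toH_val, k_H.
Qed.

Lemma nullary_term a l : good a -> exists t, idx t ∈ a /\
  forall x y, ev t x y = op l empty (fun _ => ev (leaf gen)) x y.
Proof.
  intros ha; pose proof ha as (ak & _); apply (good_mk a l empty (fun _ => leaf gen)); auto.
  - apply (ord_trans a omega); [now apply (ord_in k)| |apply ha].
    apply in_omega; now exists 0.
  - intros i hi; now apply in_empty in hi.
Qed.

Lemma num0_omega : num 0 ∈ omega.
Proof. apply in_omega; now exists 0. Qed.

Lemma value_at_unary t x y : value_at omega (fun _ => ev t) (num 0) x y = ev t x y.
Proof. unfold value_at; destruct (excluded_middle_informative _); auto; destruct n; apply num0_omega. Qed.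

Lemma hull_card a : good a -> equinumerous (hull a a) a.
Proof.
  intros ha; apply bernstein_sub.
  - intros i hi; destruct (const_term a i ha hi) as [t [h1 h2]]; apply in_hull.
    exists t; now rewrite h2.
  - destruct (choice_on (fun z => z ∈ hull a a)
      (fun z i => i ∈ a /\ exists t, idx t = i /\ z = proj1_sig (ev t a a)) empty) as [f hf].
    { intros z hz; apply in_hull in hz; destruct hz as [t [h1 h2]]; eauto. }
    exists f; split; [intros z hz; now apply hf|].
    intros z z' hz hz' e; destruct (hf z hz) as (_ & t & h1 & ->), (hf z' hz') as (_ & t' & h2 & ->).
    rewrite (idx_inj t t'); congruence.
Qed.

Lemma hull_model a : good a -> is_model a (hull a a).
Proof.
  intros ha; pose proof ha as (ak & _); split; [now apply hull_card|split; [split|split]].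
  - intros i hi; destruct (const_term a i ha hi) as [t [h1 h2]]; apply in_hull.
    exists t; now rewrite h2.
  - destruct (nullary_term a ident ha) as [t [h1 h2]]; apply in_hull; exists t; split; auto.
    rewrite h2; simpl; now rewrite toH_val; [|apply k_H].
  - destruct (nullary_term a ident ha) as [t [h1 h2]].
    assert (h3 : proj1_sig (ev t a a) ∈ hull a a) by (apply in_hull; eauto).
    apply (ZFCminus_transfer _ (sub H) incl (exist (fun z => z ∈ hull a a) _ h3 : sub (hull a a))).
    + now apply hull_elementary.
    + apply H_ZFCminus.
  - intros b f hb hf; apply function_graph in hf; destruct hf as [g [hg ->]].
    destruct (choice_on (fun i => i ∈ b) (fun i t => idx t ∈ a /\ g i = proj1_sig (ev t a a))
      (leaf gen)) as [s hs].
    { intros i hi; now apply in_hull, hg. }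
    destruct (good_mk a sequence b s ha hb) as [t [h1 h2]].
    { intros i hi; now apply hs. }
    apply in_hull; exists t; split; auto; rewrite h2; unfold op.
    assert (e : graph b g = graph b (fun i => proj1_sig (value_at b (fun i => ev (s (proj1_sig i))) i a a))).
    { apply set_ext; intros z; unfold graph; rewrite !in_img.
      split; intros [i [hi ->]]; exists i; split; auto; f_equal; unfold value_at;
        (destruct (excluded_middle_informative _); [|tauto]); simpl; [|symmetry]; now apply hs. }
    rewrite <- e; symmetry; apply toH_val, H_graph.
    + apply k_H; now apply (ord_trans k a).
    + intros i hi; apply (hull_H a a); auto.
Qed.

Lemma hull_elementary_sub a : good a -> elementary_sub (hull a a) H.
Proof. intros ha; exists incl; split; [reflexivity|now apply hull_elementary]. Qed.

Lemma gen_hull a : good a -> A a ∈ hull a a.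
Proof.
  intros ha; pose proof ha as (ak & _); destruct (nullary_term a gen ha) as [t [h1 h2]].
  apply in_hull; exists t; split; auto; rewrite h2; simpl; rewrite toH_val; auto.
  apply (H_sub a); auto; now apply k_H.
Qed.

(** * The embedding *)

Section Embedding.
Variables a b : V.
Hypotheses (ga : good a) (gb : good b) (hab : a ∈ b) (hlim : limit_good a b).

Lemma idx_up t : idx t ∈ a -> idx t ∈ b.
Proof. intros h; destruct gb as [bk _]; apply (ord_trans b a); auto; now apply (ord_in k). Qed.

Lemma truth_shift p (s : nat -> term) : (forall n, idx (s n) ∈ a) ->
  sat p (fun n => ev (s n) a a) <-> sat p (fun n => ev (s n) b b).
Proof.
  intros h; destruct ga as (_ & _ & _ & _ & h1), gb as (_ & _ & _ & _ & h2).
  rewrite h1, h2; [reflexivity|intros n; now apply idx_up|auto].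
Qed.

Lemma eq_shift t t' : idx t ∈ a -> idx t' ∈ a -> ev t a a = ev t' a a -> ev t b b = ev t' b b.
Proof.
  intros h h' e.
  apply (truth_shift (f_eq 0 1) (fun n => match n with 0 => t | _ => t' end)); auto.
  now intros [|n].
Qed.

Lemma rep_ex (x : sub (hull a a)) : exists t, idx t ∈ a /\ proj1_sig x = proj1_sig (ev t a a).
Proof. apply in_hull, proj2_sig. Qed.
(** The choice of the term is immaterial for [emb], by [eq_shift]. *)
Definition rep (x : sub (hull a a)) : term := chosen (rep_ex x).
Lemma rep_idx x : idx (rep x) ∈ a.
Proof. apply (chosenP (rep_ex x)). Qed.
Lemma rep_ev x : incl x = ev (rep x) a a.
Proof. apply sub_eq; apply (chosenP (rep_ex x)). Qed.

Lemma shift_hull t : idx t ∈ a -> proj1_sig (ev t b b) ∈ hull a b.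
Proof.
  intros h; destruct (good_unary a up t ga h) as [t' [h1 h2]]; apply in_hull.
  exists t'; split; auto; rewrite h2; simpl; now rewrite value_at_unary.
Qed.

Definition emb (x : sub (hull a a)) : sub (hull a b) :=
  exist (fun z => z ∈ hull a b) _ (shift_hull (rep x) (rep_idx x)).

Lemma emb_incl x : incl (emb x) = ev (rep x) b b.
Proof. now apply sub_eq. Qed.

Lemma emb_elementary : elementary emb.
Proof.
  intros p s.
  rewrite (hull_elementary a a ga p s), (hull_elementary a b ga p).
  replace (fun n => incl (s n)) with (fun n => ev (rep (s n)) a a).
  - replace (fun n => incl (emb (s n))) with (fun n => ev (rep (s n)) b b).
    + apply truth_shift; intros n; apply rep_idx.
    + apply functional_extensionality; intros n; symmetry; apply emb_incl.
  - apply functional_extensionality; intros n; symmetry; apply rep_ev.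
Qed.

(** Every i < a is the value of a constant term, which represents i at b as well, whereas the term
for the identity represents a at a and b at b. *)
Lemma emb_critical : critical_point emb a.
Proof.
  pose proof ga as (ak & _); pose proof gb as (bk & _); split.
  - intros x hx; destruct (const_term a _ ga hx) as [t [h1 h2]].
    assert (e : ev (rep x) b b = ev t b b).
    { apply eq_shift; auto; [apply rep_idx|]; rewrite <- rep_ev; apply sub_eq; now rewrite h2. }
    change (proj1_sig (emb x)) with (proj1_sig (ev (rep x) b b)); now rewrite e, h2.
  - destruct (nullary_term a ident ga) as [t [h1 h2]].
    assert (h3 : a ∈ hull a a) by apply (hull_model a ga).
    exists (exist (fun z => z ∈ hull a a) a h3); split; auto.
    pose (x := exist (fun z => z ∈ hull a a) a h3 : sub (hull a a)); fold x.
    assert (e : ev (rep x) b b = ev t b b).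
    { apply eq_shift; auto; [apply rep_idx|]; rewrite <- rep_ev; apply sub_eq; rewrite h2.
      simpl; rewrite toH_val; auto; now apply k_H. }
    change (proj1_sig (emb x)) with (proj1_sig (ev (rep x) b b)); rewrite e, h2; simpl.
    rewrite toH_val; [|now apply k_H]; intros E; rewrite E in hab; now apply not_in_self in hab.
Qed.

(** [low] gives the inclusion of M in N. Conversely a subset of a that is the value of t at (a, b)
has, by the choice of b, already reached the limit of the values of t at (a, z); so it is the
value at a of the term that [lim] forms from t. *)
Lemma emb_powerset : powerset_preserving emb a.
Proof.
  split; [apply emb_critical|]; pose proof ga as (ak & _); intros x hx; rewrite !in_hull; split.
  - intros [t [h1 ->]]; destruct (good_unary a low t ga h1) as [t' [h2 h3]].
    exists t'; split; auto; rewrite h3; simpl; now rewrite value_at_unary.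
  - intros [t [h1 ->]]; destruct (good_unary a lim t ga h1) as [t' [h2 h3]].
    exists t'; split; auto; rewrite h3; unfold op; rewrite toH_val.
    + apply set_ext; intros i; rewrite in_sep.
      assert (e : (fun z => i ∈ proj1_sig (value_at omega (fun _ => ev t) (num 0) a z)) =
        (fun z => i ∈ proj1_sig (ev t a z))).
      { apply functional_extensionality; intros z; now rewrite value_at_unary. }
      rewrite e; split.
      * intros hi; specialize (hx i hi); split; auto; now apply hlim.
      * intros [hi h]; now apply hlim.
    + apply (H_sub a); [now apply k_H|]; intros z hz; apply in_sep in hz; tauto.
Qed.
End Embedding.

Lemma ramsey_witness_ae : nu (fun a => exists M : V, A a ∈ M /\ is_model a M /\
  elementary_sub M H /\ exists (N : V) (j : sub M -> sub N),
    elementary j /\ powerset_preserving j a).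
Proof.
  apply (m_mono k nu hnu _ _) with (2 := good_ae); intros a ak ga.
  destruct (m_ne k nu hnu _ (m_and k nu k_omega hnu _ _ good_ae (m_and k nu k_omega hnu _ _
    (m_unif k nu hnu a ak) (limit_good_ae a ak)))) as [b [_ (gb & hab & hl)]].
  exists (hull a a); split; [now apply gen_hull|split; [now apply hull_model|]].
  split; [now apply hull_elementary_sub|].
  exists (hull a b), (emb a b ga); split.
  - now apply emb_elementary.
  - now apply emb_powerset.
Qed.
End Terms.
End Theta.

(** * Conclusion *)

Lemma opair_closure (X : V) : exists Y, X ⊆ Y /\
  forall x y, x ∈ Y -> y ∈ Y -> opair x y ∈ Y.
Proof.
  pose (F := fun n => Nat.iter n (fun S => cup S (power (power S))) X).
  assert (hF : forall m n, m <= n -> F m ⊆ F n).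
  { induction 1; intros z hz; auto; apply in_cup; auto. }
  exists (union (natimg F)); split.
  - intros z hz; apply in_union; exists (F 0); split; auto; apply in_natimg; eauto.
  - intros x y hx hy; apply in_union in hx; apply in_union in hy.
    destruct hx as [u [hu hx]], hy as [v [hv hy]]; apply in_natimg in hu; apply in_natimg in hv.
    destruct hu as [m ->], hv as [n ->].
    apply (hF m (max m n)) in hx; [|apply PeanoNat.Nat.le_max_l].
    apply (hF n (max m n)) in hy; [|apply PeanoNat.Nat.le_max_r].
    apply in_union; exists (F (S (max m n))); split; [apply in_natimg; eauto|].
    apply in_cup; right; apply in_power; intros z hz; apply in_power; intros t ht.
    apply in_upair in hz; destruct hz as [-> | ->]; apply in_upair in ht; destruct ht; now subst.
Qed.

(** The definition of Ramsey bounds theta from below by l; for each bad a choose such an l, and take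
one theta above all of them. This is possible as the choices form a set L, which injects into the
set Y that defines theta. *)
Lemma ramsey_ae k nu : ordinal k -> omega ∈ k -> measure k nu -> normal k nu -> nu ramsey.
Proof.
  intros ko kw hnu hnorm; apply NNPP; intros h; apply (m_not k nu hnu) in h.
  pose (bad := fun a theta B : V => B ⊆ a /\ ~ exists M H : V,
    B ∈ M /\ is_model a M /\ is_H theta H /\ elementary_sub M H /\
    exists (N : V) (j : sub M -> sub N), elementary j /\ powerset_preserving j a).
  destruct (m_exists k nu hnu empty (fun a l => ordinal l /\
    forall theta, l ∈ theta -> regular theta -> exists B, bad a theta B)) as [L hL].
  { apply (m_mono k nu hnu _ _) with
      (2 := m_and k nu kw hnu _ _ h (regular_ae k nu ko kw hnu hnorm)).
    intros a _ [h1 h2]; apply NNPP; intros h3; apply h1; split; auto.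
    intros l hl; apply NNPP; intros h4; apply h3; exists l; split; auto.
    intros theta h5 h6; apply NNPP; intros h7; apply h4; exists theta; split; auto; split; auto.
    intros B hB; apply NNPP; intros h8; apply h7; exists B; now split. }
  destruct (opair_closure (cup k (union (img k L)))) as [Y [hY1 hY2]].
  assert (kY : k ⊆ Y) by (intros z hz; apply hY1, in_cup; auto).
  assert (wY : omega ⊆ Y) by (intros z hz; apply kY; now apply (ord_trans k omega)).
  destruct (m_exists k nu hnu empty (fun a B => bad a (theta Y) B)) as [B hB].
  { apply (m_mono k nu hnu _ _) with (2 := hL); intros a ha [h1 h2]; apply h2.
    - apply in_theta; split; auto; apply injects_sub; intros z hz; apply hY1, in_cup; right.
      apply in_union; exists (L a); split; auto; now apply img_in.
    - now apply theta_regular. }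
  pose (B' := fun a => sep a (fun i => i ∈ B a)).
  assert (hB' : forall a, a ∈ k -> B' a ⊆ a).
  { intros a _ z hz; apply in_sep in hz; tauto. }
  pose proof (ramsey_witness_ae Y hY2 wY k nu ko kw kY hnu hnorm B' hB') as h1.
  destruct (m_ne k nu hnu _ (m_and k nu kw hnu _ _ hB h1))
    as [a [_ [[h2 h3] [M [h4 [h5 [h6 h7]]]]]]].
  apply h3; exists M, (H Y); split; [|repeat split; auto; try apply h5].
  - replace (B a) with (B' a); auto; apply set_ext; intros z; unfold B'; rewrite in_sep.
    split; [tauto|]; intros hz; split; auto.
  - intros hx; now apply (H_is_H Y).
  - intros hx; now apply (H_is_H Y).
Qed.
End Universe.

Theorem proposition5p11 (V : structure) (HV : ZFC V) (k : V) (Hk : measurable k) :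
  limit_of k (fun a => regular a /\ ramsey a).
Proof.
  pose proof Hk as [[ko _] [[w [hw kw]] _]].
  apply (is_omega_eq V HV) in hw; subst w.
  destruct (measurable_measure V HV k Hk) as [m hm].
  destruct (normal_measure V HV k m ko kw hm) as [nu [hnu hnorm]].
  intros b hb.
  destruct (m_ne V k nu hnu _ (m_and V HV k nu kw hnu _ _ (m_unif V k nu hnu b hb)
    (ramsey_ae V HV k nu ko kw hnu hnorm))) as [a [ha [hba hr]]].
  exists a; repeat split; auto; apply hr.
Qed.
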